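(* Let $R$ be an associative ring with identity. The functor $$\Psi|:\mathcal{S}(R\text{-}\mathrm{Pinj})\longrightarrow ((R\text{-}\underline{\mathrm{mod}})^{\mathrm{op}},\mathcal{A}b),\qquad (X\xrightarrow{f}Y)\longmapsto \mathrm{Cok}\big((-,Y)\to(-,\mathrm{Cok} f)\big),$$ is full, dense and objective.
   Context: $R$-module means left $R$-module. $R\text{-}\mathrm{Mod}$ is the category of all $R$-modules and $R\text{-}\mathrm{mod}$ the full subcategory of finitely presented ones. All subcategories are full. $\mathcal{A}b$ is the category of abelian groups, and $(-,M)$ denotes $\mathrm{Hom}_R(-,M)$ restricted to $R\text{-}\mathrm{mod}$. $((R\text{-}\mathrm{mod})^{\mathrm{op}},\mathcal{A}b)$ is the category of additive contravariant functors $R\text{-}\mathrm{mod}\to\mathcal{A}b$. $R\text{-}\underline{\mathrm{mod}}$ is the stable category of $R\text{-}\mathrm{mod}$ modulo projectives, and $((R\text{-}\underline{\mathrm{mod}})^{\mathrm{op}},\mathcal{A}b)$ is identified with the full subcategory of $((R\text{-}\mathrm{mod})^{\mathrm{op}},\mathcal{A}b)$ of functors vanishing on projective modules. The morphism category $\mathcal{H}(R\text{-}\mathrm{Mod})$ has as objects the morphisms $(X\xrightarrow{f}Y)$ of $R\text{-}\mathrm{Mod}$; a morphism $(X\xrightarrow{f}Y)\to(X'\xrightarrow{f'}Y')$ is a pair $(\sigma_1:X\to X',\sigma_2:Y\to Y')$ with $\sigma_2f=f'\sigma_1$. $\mathcal{S}(R\text{-}\mathrm{Pinj})$ is the full subcategory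 of all monomorphisms $(X\xrightarrow{f}Y)$ with $X$ and $Y$ pure-injective. Definition of $\Psi$: for a monomorphism $f:X\to Y$ with cokernel $g:Y\to Z$, $\Psi(f)$ is the cokernel of $(-,g):(-,Y)\to(-,Z)$ in $((R\text{-}\mathrm{mod})^{\mathrm{op}},\mathcal{A}b)$; it vanishes on projectives. For a morphism $(h_1,h_2):f\to f'$, let $h_3:Z\to Z'$ be the map induced on cokernels; then $\Psi(h_1,h_2)$ is the morphism $\Psi(f)\to\Psi(f')$ induced by $(-,h_3)$. An additive functor $F:\mathcal{X}\to\mathcal{Y}$ between additive categories is objective if every morphism $h$ of $\mathcal{X}$ with $F(h)=0$ factors through an object $K$ of $\mathcal{X}$ with $F(K)=0$ (a kernel object of $F$). Dense means essentially surjective on objects. *)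

(* Defs.v *)
From HB Require Import structures.
From mathcomp Require Import all_boot all_algebra generic_quotient ring_quotient.
From mathcomp Require Import boolp.

Set Implicit Arguments.
Unset Strict Implicit.
Unset Printing Implicit Defensive.

Import GRing.Theory.
Local Open Scope ring_scope.

(* Hom-groups are bare types with operations rather than [zmodType]s: the     *)
(* natural transformations between functors on a category of [lmodType]s live *)
(* in a universe strictly above that of [zmodType].                           *)
Record preadditive := Preadditive {
  obj :> Type;
  hom : obj -> obj -> Type;
  idm : forall X, hom X X;
  ccomp : forall X Y Z, hom Y Z -> hom X Y -> hom X Z;
  hom0 : forall X Y, hom X Y;
  homN : forall X Y, hom X Y -> hom X Y;
  homD : forall X Y, hom X Y -> hom X Y -> hom X Y;
  compA : forall W X Y Z (h : hom Y Z) (g : hom X Y) (f : hom W X),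
    ccomp h (ccomp g f) = ccomp (ccomp h g) f;
  comp1m : forall X Y (f : hom X Y), ccomp (idm Y) f = f;
  compm1 : forall X Y (f : hom X Y), ccomp f (idm X) = f;
  homDA : forall X Y, associative (@homD X Y);
  homDC : forall X Y, commutative (@homD X Y);
  hom0D : forall X Y, left_id (hom0 X Y) (@homD X Y);
  homND : forall X Y, left_inverse (hom0 X Y) (@homN X Y) (@homD X Y);
  compDl : forall X Y Z (g g' : hom Y Z) (f : hom X Y),
    ccomp (homD g g') f = homD (ccomp g f) (ccomp g' f);
  compDr : forall X Y Z (g : hom Y Z) (f f' : hom X Y),
    ccomp g (homD f f') = homD (ccomp g f) (ccomp g f')
}.

Arguments idm {p} X.
Arguments ccomp {p X Y Z} g f.
Arguments hom0 {p} X Y.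

Infix "\c" := ccomp (at level 40, left associativity).

Section PreadditiveTheory.
Variable D : preadditive.

Lemma homD_inj (X Y : D) (f g h : hom X Y) : homD f g = homD f h -> g = h.
Proof.
by move=> e; rewrite -[g]hom0D -[h]hom0D -(homND f) -!homDA e.
Qed.

Lemma homDN (X Y : D) (f : hom X Y) : homD f (homN f) = hom0 X Y.
Proof. by rewrite homDC homND. Qed.

Lemma comp0m (X Y Z : D) (f : hom X Y) : hom0 Y Z \c f = hom0 X Z.
Proof.
by apply: (@homD_inj _ _ (hom0 Y Z \c f)); rewrite -compDl hom0D homDC hom0D.
Qed.

Lemma compm0 (X Y Z : D) (f : hom Y Z) : f \c hom0 X Y = hom0 X Z.
Proof.
by apply: (@homD_inj _ _ (f \c hom0 X Y)); rewrite -compDr hom0D homDC hom0D.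
Qed.

Lemma compNl (X Y Z : D) (g : hom Y Z) (f : hom X Y) :
  homN g \c f = homN (g \c f).
Proof. by apply: (@homD_inj _ _ (g \c f)); rewrite -compDl !homDN comp0m. Qed.

Lemma compNr (X Y Z : D) (g : hom Y Z) (f : hom X Y) :
  g \c homN f = homN (g \c f).
Proof. by apply: (@homD_inj _ _ (g \c f)); rewrite -compDr !homDN compm0. Qed.

End PreadditiveTheory.

Record functor (C D : preadditive) := Functor {
  fobj :> C -> D;
  fmap : forall X Y, hom X Y -> hom (fobj X) (fobj Y);
  fmap1 : forall X, fmap (idm X) = idm (fobj X);
  fmapM : forall X Y Z (g : hom Y Z) (f : hom X Y),
    fmap (g \c f) = fmap g \c fmap f;
  fmapD : forall X Y (f g : hom X Y), fmap (homD f g) = homD (fmap f) (fmap g)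
}.

Definition zero_object (C : preadditive) (X : C) : Prop :=
  forall Y, (forall f : hom X Y, f = hom0 X Y) /\
            (forall f : hom Y X, f = hom0 Y X).

Definition isomorphic (C : preadditive) (X Y : C) : Prop :=
  exists (f : hom X Y) (g : hom Y X), g \c f = idm X /\ f \c g = idm Y.

Section FunctorProperties.
Variables (C D : preadditive) (F : functor C D).

Definition full_functor : Prop :=
  forall (X Y : C) (k : hom (F X) (F Y)), exists h : hom X Y, fmap F h = k.

Definition dense_functor : Prop := forall Y : D, exists X : C, isomorphic (F X) Y.

Definition objective_functor : Prop :=
  forall (X Y : C) (h : hom X Y), fmap F h = hom0 (F X) (F Y) ->
  exists K : C, zero_object (F K) /\
    exists (u : hom X K) (v : hom K Y), h = v \c u.

End FunctorProperties.

Definition functor_comp (C D E : preadditive)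
  (G : functor D E) (F : functor C D) : functor C E.
Proof.
refine (@Functor C E (fun X => G (F X)) (fun X Y f => fmap G (fmap F f)) _ _ _).
- by move=> X; rewrite !fmap1.
- by move=> X Y Z g f; rewrite !fmapM.
- by move=> X Y f g; rewrite !fmapD.
Defined.

Definition opcat (C : preadditive) : preadditive.
Proof.
refine (@Preadditive C (fun X Y => hom Y X) (fun X => idm X)
  (fun X Y Z g f => f \c g) (fun X Y => hom0 Y X)
  (fun X Y f => homN f) (fun X Y f g => homD f g) _ _ _ _ _ _ _ _ _).
- by move=> W X Y Z h g f; rewrite compA.
- by move=> X Y f; rewrite compm1.
- by move=> X Y f; rewrite comp1m.
- by move=> X Y; exact: homDA.
- by move=> X Y; exact: homDC.
- by move=> X Y; exact: hom0D.
- by move=> X Y; exact: homND.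
- by move=> X Y Z g g' f; rewrite compDr.
- by move=> X Y Z g f f'; rewrite compDl.
Defined.

Section FullSubcategory.
Variables (C : preadditive) (P : C -> Prop).

Definition fullsub : preadditive.
Proof.
refine (@Preadditive {X : C | P X} (fun X Y => hom (sval X) (sval Y))
  (fun X => idm (sval X)) (fun X Y Z g f => g \c f)
  (fun X Y => hom0 (sval X) (sval Y))
  (fun X Y f => homN f) (fun X Y f g => homD f g) _ _ _ _ _ _ _ _ _).
- by move=> *; exact: compA.
- by move=> *; exact: comp1m.
- by move=> *; exact: compm1.
- by move=> *; exact: homDA.
- by move=> *; exact: homDC.
- by move=> *; exact: hom0D.
- by move=> *; exact: homND.
- by move=> *; exact: compDl.
- by move=> *; exact: compDr.
Defined.

Definition incl : functor fullsub C :=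
  @Functor fullsub C (fun X => sval X) (fun X Y f => f)
    (fun=> erefl) (fun _ _ _ _ _ => erefl) (fun _ _ _ _ => erefl).

Definition corestrict (B : preadditive) (F : functor B C)
  (PF : forall X, P (F X)) : functor B fullsub :=
  @Functor B fullsub (fun X => exist _ (F X) (PF X)) (fun X Y f => fmap F f)
    (fun X => fmap1 F X) (fun X Y Z g f => fmapM F g f)
    (fun X Y f g => fmapD F f g).

End FullSubcategory.

Record nattrans (C D : preadditive) (F G : functor C D) := NatTrans {
  ntfun :> forall X : C, hom (F X) (G X);
  ntP : forall X Y (f : hom X Y), ntfun Y \c fmap F f = fmap G f \c ntfun X
}.

Section FunctorCategory.
Variables (C D : preadditive).

Lemma nattrans_ext (F G : functor C D) (a b : nattrans F G) :
  (forall X, a X = b X) -> a = b.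
Proof.
case: a b => [a aP] [b bP] /= ab.
have {}ab : a = b by exact: functional_extensionality_dep.
by subst b; congr NatTrans; exact: Prop_irrelevance.
Qed.

Section Ops.
Variables (F G H : functor C D).

Definition nt_id : nattrans F F.
Proof.
by refine (@NatTrans _ _ F F (fun X => idm (F X)) _) => X Y f;
  rewrite comp1m compm1.
Defined.

Definition nt_comp (b : nattrans G H) (a : nattrans F G) : nattrans F H.
Proof.
by refine (@NatTrans _ _ F H (fun X => b X \c a X) _) => X Y f;
  rewrite -compA ntP compA ntP compA.
Defined.

Definition nt0 : nattrans F G.
Proof.
by refine (@NatTrans _ _ F G (fun X => hom0 (F X) (G X)) _) => X Y f;
  rewrite comp0m compm0.
Defined.

Definition ntN (a : nattrans F G) : nattrans F G.
Proof.
by refine (@NatTrans _ _ F G (fun X => homN (a X)) _) => X Y f;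
  rewrite compNl compNr ntP.
Defined.

Definition ntD (a b : nattrans F G) : nattrans F G.
Proof.
by refine (@NatTrans _ _ F G (fun X => homD (a X) (b X)) _) => X Y f;
  rewrite compDl compDr !ntP.
Defined.

End Ops.

Definition funcat : preadditive.
Proof.
refine (@Preadditive (functor C D) (@nattrans C D) nt_id nt_comp nt0 ntN ntD
  _ _ _ _ _ _ _ _ _).
- by move=> *; apply: nattrans_ext => ?; exact: compA.
- by move=> *; apply: nattrans_ext => ?; exact: comp1m.
- by move=> *; apply: nattrans_ext => ?; exact: compm1.
- by move=> F G a b c; apply: nattrans_ext => ?; exact: homDA.
- by move=> F G a b; apply: nattrans_ext => ?; exact: homDC.
- by move=> F G a; apply: nattrans_ext => ?; exact: hom0D.
- by move=> F G a; apply: nattrans_ext => ?; exact: homND.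
- by move=> *; apply: nattrans_ext => ?; exact: compDl.
- by move=> *; apply: nattrans_ext => ?; exact: compDr.
Defined.

End FunctorCategory.

Record arrow (C : preadditive) := Arrow {
  src : C; tgt : C; arr :> hom src tgt
}.

Record square (C : preadditive) (f f' : arrow C) := Square {
  sq1 : hom (src f) (src f');
  sq2 : hom (tgt f) (tgt f');
  sqP : sq2 \c f = f' \c sq1
}.

Section MorphismCategory.
Variable C : preadditive.

Lemma square_ext (f f' : arrow C) (s t : square f f') :
  sq1 s = sq1 t -> sq2 s = sq2 t -> s = t.
Proof.
case: s t => [s1 s2 sP] [t1 t2 tP] /= e1 e2; subst t1 t2.
by congr Square; exact: Prop_irrelevance.
Qed.

Definition sq_id (f : arrow C) : square f f.
Proof. by refine (@Square _ f f (idm _) (idm _) _); rewrite comp1m compm1. Defined.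

Definition sq_comp (f g h : arrow C) (t : square g h) (s : square f g) :
  square f h.
Proof.
by refine (@Square _ f h (sq1 t \c sq1 s) (sq2 t \c sq2 s) _);
  rewrite -compA sqP compA sqP compA.
Defined.

Definition sq0 (f g : arrow C) : square f g.
Proof. by refine (@Square _ f g (hom0 _ _) (hom0 _ _) _); rewrite comp0m compm0. Defined.

Definition sqN (f g : arrow C) (s : square f g) : square f g.
Proof.
by refine (@Square _ f g (homN (sq1 s)) (homN (sq2 s)) _);
  rewrite compNl compNr sqP.
Defined.

Definition sqD (f g : arrow C) (s t : square f g) : square f g.
Proof.
by refine (@Square _ f g (homD (sq1 s) (sq1 t)) (homD (sq2 s) (sq2 t)) _);
  rewrite compDl compDr !sqP.
Defined.

Definition morcat : preadditive.
Proof.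
refine (@Preadditive (arrow C) (@square C) sq_id sq_comp sq0 sqN sqD
  _ _ _ _ _ _ _ _ _).
- by move=> *; apply: square_ext; exact: compA.
- by move=> *; apply: square_ext; exact: comp1m.
- by move=> *; apply: square_ext; exact: compm1.
- by move=> f g a b c; apply: square_ext; exact: homDA.
- by move=> f g a b; apply: square_ext; exact: homDC.
- by move=> f g a; apply: square_ext; exact: hom0D.
- by move=> f g a; apply: square_ext; exact: homND.
- by move=> *; apply: square_ext; exact: compDl.
- by move=> *; apply: square_ext; exact: compDr.
Defined.

End MorphismCategory.

Lemma additive_ext (U V : zmodType) (f g : {additive U -> V}) :
  f =1 g -> f = g.
Proof.
case: f g => [f [[fP]]] [g [[gP]]] /= fg.
have {}fg : f = g by exact: funext.
by subst g; congr GRing.Additive.Pack; rewrite (Prop_irrelevance fP gP).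
Qed.

Lemma linear_ext (R : pzRingType) (U V : lmodType R) (f g : {linear U -> V}) :
  f =1 g -> f = g.
Proof.
case: f g => [f [[fP] [fQ]]] [g [[gP] [gQ]]] /= fg.
have {}fg : f = g by exact: funext.
subst g; congr GRing.Linear.Pack.
by rewrite (Prop_irrelevance fP gP) (Prop_irrelevance fQ gQ).
Qed.

Definition Ab : preadditive.
Proof.
refine (@Preadditive zmodType (fun U V => {additive U -> V})
  (fun U => idfun : {additive U -> U})
  (fun U V W g f => (g \o f : U -> W) : {additive U -> W})
  (fun U V => (\0 : U -> V) : {additive U -> V})
  (fun U V f => (\- f : U -> V) : {additive U -> V})
  (fun U V f g => (f \+ g : U -> V) : {additive U -> V})
  _ _ _ _ _ _ _ _ _).
- by move=> *; exact: additive_ext.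
- by move=> *; exact: additive_ext.
- by move=> *; exact: additive_ext.
- by move=> U V f g h; apply: additive_ext => x /=; rewrite addrA.
- by move=> U V f g; apply: additive_ext => x /=; rewrite addrC.
- by move=> U V f; apply: additive_ext => x /=; rewrite add0r.
- by move=> U V f; apply: additive_ext => x /=; rewrite addNr.
- by move=> *; exact: additive_ext.
- by move=> U V W g f f'; apply: additive_ext => x /=; rewrite raddfD.
Defined.

Definition Mod (R : pzRingType) : preadditive.
Proof.
refine (@Preadditive (lmodType R) (fun U V => {linear U -> V})
  (fun U => idfun : {linear U -> U})
  (fun U V W g f => (g \o f : U -> W) : {linear U -> W})
  (fun U V => (\0 : U -> V) : {linear U -> V})
  (fun U V f => (\- f : U -> V) : {linear U -> V})
  (fun U V f g => (f \+ g : U -> V) : {linear U -> V})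
  _ _ _ _ _ _ _ _ _).
- by move=> *; exact: linear_ext.
- by move=> *; exact: linear_ext.
- by move=> *; exact: linear_ext.
- by move=> U V f g h; apply: linear_ext => x /=; rewrite addrA.
- by move=> U V f g; apply: linear_ext => x /=; rewrite addrC.
- by move=> U V f; apply: linear_ext => x /=; rewrite add0r.
- by move=> U V f; apply: linear_ext => x /=; rewrite addNr.
- by move=> *; exact: linear_ext.
- by move=> U V W g f f'; apply: linear_ext => x /=; rewrite raddfD.
Defined.

Section AdditiveCokernel.
Variables (U V : zmodType) (f : {additive U -> V}).

Definition img : {pred V} := [pred y | `[< exists x, f x = y >]].

Lemma imgP y : reflect (exists x, f x = y) (y \in img).
Proof. exact: asboolP. Qed.

Lemma img_zmod_closed : zmod_closed img.
Proof.
split=> [|_ _ /imgP[x <-] /imgP[y <-]]; apply/imgP.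
  by exists 0; rewrite raddf0.
by exists (x - y); rewrite raddfB.
Qed.

HB.instance Definition _ := GRing.isZmodClosed.Build V img img_zmod_closed.

Definition coker : zmodType := Quotient.quot img.

Definition cokpi : V -> coker := \pi_(Quotient.quot img)%qT.

Lemma cokpi_zmod_morphism : zmod_morphism cokpi.
Proof. exact: pi_is_zmod_morphism. Qed.

HB.instance Definition _ :=
  GRing.isZmodMorphism.Build V coker cokpi cokpi_zmod_morphism.

Definition cokrepr (c : coker) : V := repr (c : Quotient.quot img).

Lemma cokreprK : cancel cokrepr cokpi.
Proof. exact: reprK. Qed.

Lemma cokpi_eq0 y : cokpi y = 0 <-> exists x, f x = y.
Proof.
rewrite -[0](raddf0 cokpi); split.
  by move/eqP; rewrite -Quotient.idealrBE subr0 => /imgP.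
by move=> yf; apply/eqP; rewrite -Quotient.idealrBE subr0; apply/imgP.
Qed.

End AdditiveCokernel.

Section InducedMap.
Variables (U V U' V' : zmodType).
Variables (f : {additive U -> V}) (f' : {additive U' -> V'}).
Variables (v : {additive V -> V'}).
Hypothesis vf : forall x, exists x', f' x' = v (f x).

Definition coker_map (c : coker f) : coker f' := cokpi f' (v (cokrepr c)).

Lemma coker_mapE y : coker_map (cokpi f y) = cokpi f' (v y).
Proof.
apply/eqP; rewrite -subr_eq0 -!raddfB; apply/eqP/cokpi_eq0.
have /cokpi_eq0[x <-] : cokpi f (cokrepr (cokpi f y) - y) = 0.
  by rewrite cokpi_zmod_morphism cokreprK subrr.
exact: vf.
Qed.

Lemma coker_map_zmod_morphism : zmod_morphism coker_map.
Proof.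
move=> c d; rewrite -[c]cokreprK -[d]cokreprK -raddfB !coker_mapE.
by rewrite !raddfB.
Qed.

Definition coker_additive : {additive coker f -> coker f'} :=
  HB.pack coker_map
    (GRing.isZmodMorphism.Build _ _ coker_map coker_map_zmod_morphism).

Lemma coker_additiveE y : coker_additive (cokpi f y) = cokpi f' (v y).
Proof. exact: coker_mapE. Qed.

End InducedMap.

Section LinearCokernel.
Variables (R : pzRingType) (U V : lmodType R) (f : {linear U -> V}).

Definition lcoker : Type := coker f.
HB.instance Definition _ := GRing.Zmodule.on lcoker.

Definition lcokpi : V -> lcoker := cokpi f.
Definition lcokrepr : lcoker -> V := @cokrepr _ _ f.

Lemma lcokreprK : cancel lcokrepr lcokpi.
Proof. exact: cokreprK. Qed.

Lemma lcokpi_eq0 y : lcokpi y = 0 <-> exists x, f x = y.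
Proof. exact: cokpi_eq0. Qed.

Lemma lcokpi_zmod_morphism : zmod_morphism lcokpi.
Proof. exact: cokpi_zmod_morphism. Qed.

Lemma lcokpi_eq y z : lcokpi y = lcokpi z <-> exists x, f x = y - z.
Proof.
by rewrite -lcokpi_eq0 lcokpi_zmod_morphism; split=> [->|/subr0_eq//]; rewrite subrr.
Qed.

Definition coker_scale (a : R) (c : lcoker) : lcoker := lcokpi (a *: lcokrepr c).

Lemma coker_scaleE a y : coker_scale a (lcokpi y) = lcokpi (a *: y).
Proof.
apply/lcokpi_eq; have /lcokpi_eq[x fx] := lcokreprK (lcokpi y).
by exists (a *: x); rewrite linearZ_LR fx scalerBr.
Qed.

Lemma lcokpiD y z : lcokpi (y + z) = lcokpi y + lcokpi z.
Proof. exact: (raddfD (cokpi f)). Qed.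

Lemma coker_scaleA a b c : coker_scale a (coker_scale b c) = coker_scale (a * b) c.
Proof. by rewrite -[c]lcokreprK !coker_scaleE scalerA. Qed.

Lemma coker_scale1 : left_id 1 coker_scale.
Proof. by move=> c; rewrite -[c]lcokreprK coker_scaleE scale1r. Qed.

Lemma coker_scaleDr : right_distributive coker_scale +%R.
Proof.
move=> a c d; rewrite -[c]lcokreprK -[d]lcokreprK -lcokpiD !coker_scaleE.
by rewrite scalerDr lcokpiD.
Qed.

Lemma coker_scaleDl c : {morph coker_scale^~ c : a b / a + b}.
Proof. by move=> a b; rewrite -[c]lcokreprK !coker_scaleE scalerDl lcokpiD. Qed.

HB.instance Definition _ := GRing.Zmodule_isLmodule.Build R lcoker
  coker_scaleA coker_scale1 coker_scaleDr coker_scaleDl.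

Lemma lcokpi_linear : linear lcokpi.
Proof. by move=> a y z; rewrite lcokpiD -coker_scaleE. Qed.

HB.instance Definition _ := GRing.isLinear.Build R V lcoker *:%R lcokpi lcokpi_linear.

Definition Cok : lmodType R := lcoker.
Definition pi_Cok : {linear V -> Cok} := lcokpi.

End LinearCokernel.

Section InducedLinear.
Variables (R : pzRingType) (U V U' V' : lmodType R).
Variables (f : {linear U -> V}) (f' : {linear U' -> V'}) (v : {linear V -> V'}).
Hypothesis vf : forall x, exists x', f' x' = v (f x).

Definition Cok_map (c : Cok f) : Cok f' := coker_map f' v c.

Lemma Cok_mapE y : Cok_map (pi_Cok f y) = pi_Cok f' (v y).
Proof. exact: coker_mapE. Qed.

Lemma Cok_map_linear : linear Cok_map.
Proof.
move=> a c d; rewrite -[c]lcokreprK -[d]lcokreprK -linearP !Cok_mapE.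
by rewrite !linearP.
Qed.

Definition Cok_linear : {linear Cok f -> Cok f'} :=
  HB.pack Cok_map (GRing.isLinear.Build _ _ _ _ Cok_map Cok_map_linear).

Lemma Cok_linearE y : Cok_linear (pi_Cok f y) = pi_Cok f' (v y).
Proof. exact: Cok_mapE. Qed.

End InducedLinear.

Section ModuleClasses.
Variable R : pzRingType.

(* There is an exact sequence R^m -> R^n -> M -> 0. *)
Definition finitely_presented (M : lmodType R) : Prop :=
  exists (m n : nat) (q : {linear 'rV[R]_m -> 'rV[R]_n})
         (p : {linear 'rV[R]_n -> M}),
    (forall y, exists v, p v = y) /\
    (forall v, p v = 0 <-> exists w, q w = v).

Definition projective (P : lmodType R) : Prop :=
  forall (A B : lmodType R) (g : {linear A -> B}) (h : {linear P -> B}),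
    (forall b, exists a, g a = b) ->
    exists h' : {linear P -> A}, forall x, g (h' x) = h x.

(* f is a monomorphism and 0 -> (-, A) -> (-, B) -> (-, Cok f) -> 0 is exact  *)
(* on finitely presented modules.                                             *)
Definition pure_mono (A B : lmodType R) (f : {linear A -> B}) : Prop :=
  injective f /\
  forall (M : lmodType R) (h : {linear M -> Cok f}), finitely_presented M ->
    exists h' : {linear M -> B}, forall x, pi_Cok f (h' x) = h x.

Definition pure_injective (N : lmodType R) : Prop :=
  forall (A B : lmodType R) (f : {linear A -> B}) (h : {linear A -> N}),
    pure_mono f -> exists h' : {linear B -> N}, forall x, h' (f x) = h x.

Definition fpmod : preadditive := @fullsub (Mod R) finitely_presented.

End ModuleClasses.

Section HomGroup.
Variables (R : pzRingType) (M N : lmodType R).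

Definition homgroup : Type := {linear M -> N}.

HB.instance Definition _ := gen_eqMixin homgroup.
HB.instance Definition _ := gen_choiceMixin homgroup.

Let C := Mod R.
HB.instance Definition _ := GRing.isZmodule.Build homgroup
  (@homDA C M N) (@homDC C M N) (@hom0D C M N) (@homND C M N).

End HomGroup.

Section HomFunctor.
Variable R : pzRingType.

Section Composition.
Variables (M M' N N' : lmodType R) (u : {linear M' -> M}) (g : {linear N -> N'}).

Definition precomp (h : homgroup M N) : homgroup M' N :=
  ((h : {linear M -> N}) \o u : M' -> N) : {linear M' -> N}.

Definition postcomp (h : homgroup M N) : homgroup M N' :=
  (g \o (h : {linear M -> N}) : M -> N') : {linear M -> N'}.

Lemma precomp_zmod_morphism : zmod_morphism precomp.
Proof. by move=> h k; apply: linear_ext. Qed.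

Lemma postcomp_zmod_morphism : zmod_morphism postcomp.
Proof. by move=> h k; apply: linear_ext => x; exact: (raddfB g). Qed.

HB.instance Definition _ := GRing.isZmodMorphism.Build
  (homgroup M N) (homgroup M' N) precomp precomp_zmod_morphism.
HB.instance Definition _ := GRing.isZmodMorphism.Build
  (homgroup M N) (homgroup M N') postcomp postcomp_zmod_morphism.

End Composition.

(* (-, Y) restricted to finitely presented modules. *)
Definition hom_functor (Y : lmodType R) : functor (opcat (fpmod R)) Ab.
Proof.
refine (@Functor (opcat (fpmod R)) Ab
  (fun M => homgroup (sval M) Y : zmodType)
  (fun M M' u => precomp u : {additive homgroup (sval M) Y -> homgroup (sval M') Y})
  _ _ _).
- by move=> M; apply: additive_ext => h; exact: linear_ext.
- by move=> M M' M'' v u; apply: additive_ext => h; exact: linear_ext.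
- move=> M M' u v; apply: additive_ext => h; apply: linear_ext => x.
  exact: (raddfD (h : {linear sval M -> Y})).
Defined.

Definition hom_nat (Y Z : lmodType R) (g : {linear Y -> Z}) :
  nattrans (hom_functor Y) (hom_functor Z).
Proof.
refine (@NatTrans _ _ (hom_functor Y) (hom_functor Z)
  (fun M => postcomp g : {additive homgroup (sval M) Y -> homgroup (sval M) Z})
  _).
by move=> M M' u; apply: additive_ext => h; exact: linear_ext.
Defined.

End HomFunctor.

Lemma nat_app (C : preadditive) (F G : functor C Ab)
  (a : nattrans F G) (X Y : C) (f : hom X Y) (x : F X) :
  a Y (fmap F f x) = fmap G f (a X x).
Proof. exact: (congr1 (fun k : {additive F X -> G Y} => k x) (ntP a f)). Qed.

Lemma coker_ext (U V : zmodType) (g : {additive U -> V}) (W : zmodType)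
  (k l : {additive coker g -> W}) :
  (forall y, k (cokpi g y) = l (cokpi g y)) -> k = l.
Proof. by move=> kl; apply: additive_ext => c; rewrite -[c]cokreprK. Qed.

Section FunctorCokernel.
Variables (C : preadditive) (F G : functor C Ab) (a : nattrans F G).

Lemma cok_functor_subproof X Y (f : hom X Y) (x : F X) :
  exists y : F Y, a Y y = fmap G f (a X x).
Proof. by exists (fmap F f x); rewrite nat_app. Qed.

(* Cokernels of natural transformations are computed objectwise. *)
Definition cok_functor : functor C Ab.
Proof.
refine (@Functor C Ab (fun X => coker (a X))
  (fun X Y f => coker_additive (cok_functor_subproof f)) _ _ _).
- by move=> X; apply: coker_ext => y; rewrite coker_additiveE fmap1.
- move=> X Y Z g f; apply: coker_ext => y.
  by rewrite /= !(coker_mapE (cok_functor_subproof _)) fmapM.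
- move=> X Y f g; apply: coker_ext => y.
  rewrite /= !(coker_mapE (cok_functor_subproof _)) fmapD.
  exact: (raddfD (cokpi (a Y))).
Defined.

Definition cok_nat : nattrans G cok_functor.
Proof.
refine (@NatTrans C Ab G cok_functor (fun X => cokpi (a X) : {additive _ -> _}) _).
by move=> X Y f; apply: additive_ext => y; rewrite /= (coker_mapE (cok_functor_subproof _)).
Defined.

Lemma cok_nat0 : nt_comp cok_nat a = nt0 F cok_functor.
Proof.
apply: nattrans_ext => X; apply: additive_ext => x.
by apply/cokpi_eq0; exists x.
Qed.

Lemma cok_natP (H : functor C Ab) (b : nattrans G H) :
  nt_comp b a = nt0 F H ->
  exists! c : nattrans cok_functor H, nt_comp c cok_nat = b.
Proof.
move=> ba.
have b0 X x : b X (a X x) = 0.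
  exact: (congr1 (fun n : nattrans F H => (n X : {additive _ -> _}) x) ba).
have bK X y : b X (cokrepr (cokpi (a X) y)) = b X y.
  apply/eqP; rewrite -subr_eq0 -(raddfB (b X)); apply/eqP.
  have /cokpi_eq0[x <-] : cokpi (a X) (cokrepr (cokpi (a X) y) - y) = 0.
    by rewrite cokpi_zmod_morphism cokreprK subrr.
  exact: b0.
pose k X (c : coker (a X)) : (H X : zmodType) := b X (cokrepr c).
have kE : forall X y, k X (cokpi (a X) y) = b X y by exact: bK.
have kB X : zmod_morphism (k X).
  move=> c d; rewrite -[c]cokreprK -[d]cokreprK -(raddfB (cokpi (a X))) !kE.
  exact: (raddfB (b X)).
pose kX X : {additive coker (a X) -> (H X : zmodType)} :=
  HB.pack (k X) (GRing.isZmodMorphism.Build _ _ (k X) (@kB X)).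
have kP X Y (f : hom X Y) :
    (kX Y : @hom Ab _ _) \c fmap cok_functor f = fmap H f \c (kX X : @hom Ab _ _).
  apply: coker_ext => y; rewrite /= (coker_mapE (cok_functor_subproof _)) !kE.
  exact: nat_app.
exists (@NatTrans _ _ cok_functor H kX kP); split.
  by apply: nattrans_ext => X; apply: additive_ext => y; exact: kE.
move=> c cb; apply: nattrans_ext => X; apply: coker_ext => y.
by rewrite /= kE -cb.
Qed.

End FunctorCokernel.

Section Psi.
Variable R : pzRingType.
Let H := morcat (Mod R).

Lemma square_app (f f' : H) (s : hom f f') x :
  (sq2 s : {linear _ -> _}) ((arr f : {linear _ -> _}) x) =
  (arr f' : {linear _ -> _}) ((sq1 s : {linear _ -> _}) x).
Proof.
exact: (congr1 (fun k : {linear src f -> tgt f'} => k x) (sqP s)).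
Qed.

Lemma square_cok_subproof (f f' : H) (s : hom f f') x :
  exists x', (arr f' : {linear _ -> _}) x' =
             (sq2 s : {linear _ -> _}) ((arr f : {linear _ -> _}) x).
Proof. by exists ((sq1 s : {linear _ -> _}) x); rewrite square_app. Qed.

(* The map h3 : Cok f -> Cok f' induced on cokernels by s = (h1, h2). *)
Definition square_cok (f f' : H) (s : hom f f') :
    {linear Cok (arr f) -> Cok (arr f')} :=
  Cok_linear (square_cok_subproof s).

Lemma square_cokE (f f' : H) (s : hom f f') y :
  square_cok s (pi_Cok (arr f) y) = pi_Cok (arr f') ((sq2 s : {linear _ -> _}) y).
Proof. exact: Cok_linearE. Qed.

Lemma pi_Cok_surj (f : H) (c : Cok (arr f)) : exists y, c = pi_Cok (arr f) y.
Proof. by exists (lcokrepr c); exact/esym/lcokreprK. Qed.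

Lemma square_cok1 (f : H) c : square_cok (idm f) c = c.
Proof. by have [y ->] := pi_Cok_surj c; exact: square_cokE. Qed.

Lemma square_cokM (f f' f'' : H) (t : hom f' f'') (s : hom f f') c :
  square_cok (t \c s) c = square_cok t (square_cok s c).
Proof.
have [y ->] := pi_Cok_surj c; apply: (etrans (square_cokE _ _)); apply: esym.
apply: (etrans (congr1 _ (square_cokE _ _))).
exact: (square_cokE t).
Qed.

Lemma square_cokD (f f' : H) (s t : hom f f') c :
  square_cok (homD s t) c = square_cok s c + square_cok t c.
Proof.
have [y ->] := pi_Cok_surj c; apply: (etrans (square_cokE _ _)).
apply: (etrans (raddfD (pi_Cok (arr f')) _ _)).
by congr (_ + _); apply: esym; exact: square_cokE.
Qed.

Definition Psi_obj (f : H) : functor (opcat (fpmod R)) Ab :=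
  cok_functor (hom_nat (pi_Cok (arr f))).

Lemma Psi_hom_subproof (f f' : H) (s : hom f f') (M : fpmod R)
    (h : homgroup (sval M) (tgt f)) :
  exists h' : homgroup (sval M) (tgt f'),
    postcomp (pi_Cok (arr f')) h' =
    postcomp (square_cok s) (postcomp (pi_Cok (arr f)) h).
Proof.
exists (postcomp (sq2 s) h); apply: linear_ext => x; apply: esym.
exact: (Cok_linearE (square_cok_subproof s)).
Qed.

Definition Psi_hom (f f' : H) (s : hom f f') : nattrans (Psi_obj f) (Psi_obj f').
Proof.
refine (@NatTrans _ _ (Psi_obj f) (Psi_obj f')
  (fun M => coker_additive (@Psi_hom_subproof f f' s M)) _).
move=> M M' u; apply: coker_ext => h.
have Eu := coker_additiveE (cok_functor_subproof (hom_nat (pi_Cok (arr f))) u) h.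
have Eu' := coker_additiveE (cok_functor_subproof (hom_nat (pi_Cok (arr f'))) u)
  (postcomp (square_cok s) h).
have Es := coker_additiveE (@Psi_hom_subproof f f' s M) h.
have Es' := coker_additiveE (@Psi_hom_subproof f f' s M') (precomp u h).
apply: (etrans (congr1 _ Eu)); apply: (etrans Es'); apply: esym.
apply: (etrans (congr1 _ Es)); apply: (etrans Eu').
by congr cokpi; exact: linear_ext.
Defined.

Lemma Psi_homE (f f' : H) (s : hom f f') (M : fpmod R)
    (h : homgroup (sval M) (Cok (arr f))) :
  (Psi_hom s M : {additive _ -> _}) (cokpi _ h) = cokpi _ (postcomp (square_cok s) h).
Proof. exact: (coker_additiveE (@Psi_hom_subproof f f' s M)). Qed.

Definition Psi_H : functor H (funcat (opcat (fpmod R)) Ab).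
Proof.
refine (@Functor H (funcat _ _) Psi_obj Psi_hom _ _ _).
- move=> f; apply: nattrans_ext => M; apply: coker_ext => h.
  apply: (etrans (Psi_homE _ _)); congr cokpi; apply: linear_ext => x.
  exact: square_cok1.
- move=> f f' f'' t s; apply: nattrans_ext => M; apply: coker_ext => h.
  apply: (etrans (Psi_homE _ _)); apply: esym.
  apply: (etrans (congr1 _ (Psi_homE s h))); apply: (etrans (Psi_homE t _)).
  by congr cokpi; apply: linear_ext => x; apply: esym; exact: square_cokM.
- move=> f f' s t; apply: nattrans_ext => M; apply: coker_ext => h.
  apply: (etrans (Psi_homE _ _)); apply: esym.
  apply: (etrans (congr2 _ (Psi_homE s h) (Psi_homE t h))).
  apply: (etrans (esym (raddfD (cokpi _) _ _))).
  by congr cokpi; apply: linear_ext => x; apply: esym; exact: square_cokD.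
Defined.

(* Additive functors on the stable category of R-mod, identified with the     *)
(* additive functors on R-mod that vanish on projective modules.              *)
Definition vanishes_on_projectives (F : functor (opcat (fpmod R)) Ab) : Prop :=
  forall P : fpmod R, projective (sval P) -> forall x : (F P : zmodType), x = 0.

Definition stable_funcat : preadditive :=
  @fullsub (funcat (opcat (fpmod R)) Ab) vanishes_on_projectives.

Lemma Psi_vanishes (f : H) : vanishes_on_projectives (Psi_obj f).
Proof.
move=> P projP x; rewrite -[x]cokreprK; apply/cokpi_eq0.
have [|k kE] := projP _ _ (pi_Cok (arr f)) (cokrepr x : {linear _ -> _}).
  by move=> c; have [y ->] := pi_Cok_surj c; exists y.
by exists k; exact: linear_ext.
Qed.

Definition mono_Pinj (f : H) : Prop :=
  [/\ injective (arr f : {linear _ -> _}),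
      pure_injective (src f : lmodType R) & pure_injective (tgt f : lmodType R)].

Definition S_Pinj : preadditive := @fullsub H mono_Pinj.

Definition Psi : functor S_Pinj stable_funcat :=
  functor_comp (@corestrict _ _ _ Psi_H Psi_vanishes) (incl mono_Pinj).

End Psi.

(* Main.v *)
(* Key point: if f : X -> Y is mono with X pure-injective, and u : L -> Cok f *)
(* lifts to Y along every map M -> L from a finitely presented M, then u      *)
(* lifts to L -> Y. The local lifts are glued by a linear limit X^I -> X      *)
(* along the filter of finite sets of linear relations of L; such limits      *)
(* exist on double character duals, by injectivity of Q/Z, and pass to the    *)
(* direct summand X.                                                          *)
(* Objectivity: if Psi(h) = 0, then h3 lifts to Y', which makes h             *)
(* null-homotopic, so h factors through the split mono X' -> X' (+) Y'.       *)
(* Fullness: Psi f -> Psi f' lifts to a map P -> Z' on a pure cover P -> Z by *)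
(* a direct sum of finitely presented modules, is corrected by a map P -> Y'  *)
(* to vanish on the kernel of P -> Z, and the resulting h3 lifts to Y -> Y'.  *)
(* Density: F has a presentation (-, P1) -> (-, P0) -> F -> 0 with P1 -> P0   *)
(* onto, as F vanishes on projectives; push its kernel out along a pure       *)
(* embedding into a pure-injective X to get Q with Q / X = P0, and embed Q    *)
(* purely in a pure-injective Y. Then Psi (X -> Y) is isomorphic to F.        *)
From HB Require Import structures.
From mathcomp Require Import all_boot all_order all_algebra.
From mathcomp Require Import boolp classical_sets functions filter fsbigop.
Require Import Defs.

Set Implicit Arguments.
Unset Strict Implicit.
Unset Printing Implicit Defensive.

Import Order.TTheory GRing.Theory Num.Theory.
Local Open Scope ring_scope.

(** * Characters of abelian groups *)

(** An element of [Psi f] at a finitely presented [M] is a map [M -> Cok f] modulo those that lift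
    to [Y]. Hence a statement about [Psi] yields lifts over finitely presented modules only, and the
    work is to assemble them into one lift. [lift_of_local_lifts] does this: a lift of [L -> Cok f]
    solves an infinite linear system over [X], finite subsystems are solvable by
    [finite_approximation], and a linear limit combines their solutions.

    Limits in Q/Z come from extending characters ([character_extension]), are taken pointwise on
    double duals ([dual2_limits]), and reach every pure-injective [X] through the pure embedding
    [to_dual2_pure]. Conversely, [limits_pure_injective] makes double duals pure-injective, so every
    module embeds purely in a pure-injective one.

    Objectivity and fullness lift into the target monomorphism. Fullness and density pass between
    functors and modules by Yoneda's lemma for direct sums of finitely presented modules
    ([nat_dsum], [functor_cover]); density then rests on [pure_injective_copresentation]. *)

Definition additive_of (U V : zmodType) (f : U -> V) (fB : zmod_morphism f) :
    {additive U -> V} :=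
  HB.pack f (GRing.isZmodMorphism.Build _ _ f fB).

Definition linear_of (R : pzRingType) (U V : lmodType R) (f : U -> V)
    (fL : linear f) : {linear U -> V} :=
  HB.pack f (GRing.isLinear.Build _ _ _ _ f fL).

Definition ratZ : zmodType := coker (intmul (1 : rat)).

Lemma ratZ_divisible (e : ratZ) (n : nat) :
  (0 < n)%N -> exists e', e' *+ n = e.
Proof.
move=> n0; exists (cokpi (intmul (1 : rat)) (cokrepr e / n%:R)).
rewrite -raddfMn -[_ / _ *+ n]mulr_natr mulfVK ?pnatr_eq0 -?lt0n//.
exact: cokreprK.
Qed.

Lemma ratZ_torsion (n : nat) : (1 < n)%N ->
  exists e : ratZ, e <> 0 /\ e *+ n = 0.
Proof.
move=> n1; exists (cokpi (intmul (1 : rat)) n%:R^-1); split.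
  move=> /cokpi_eq0[z zn].
  have n0 : n%:R != 0 :> rat by rewrite pnatr_eq0; case: n n1 {zn}.
  have : z * n%:Z = 1.
    by apply: (@intr_inj rat); rewrite rmorphM /= zn mulVf.
  by move/intUnitRing.unitzPl; case: n n1 {zn n0} => [|[]].
rewrite -raddfMn -[_ *+ n]mulr_natr mulVf ?pnatr_eq0; last by case: n n1.
by apply/cokpi_eq0; exists 1.
Qed.

Section CharacterExtension.
Variable V : zmodType.

(** [G] is the graph of a homomorphism from a subgroup of [V] to Q/Z. With graphs, extension is
    inclusion and chains have unions. *)
Definition partial_character (G : V * ratZ -> Prop) : Prop :=
  [/\ G 0, forall x y, G x -> G y -> G (x - y) & forall e, G (0, e) -> e = 0].

Lemma partial_characterMn G x n : partial_character G -> G x -> G (x *+ n).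
Proof.
case=> G0 GB Gf Gx; elim: n => // n IHn.
by rewrite mulrS -[x *+ n]opprK; apply: (GB) => //; rewrite -sub0r; exact: GB.
Qed.

Lemma partial_characterMz G x (z : int) :
  partial_character G -> G x -> G (x *~ z).
Proof.
move=> pG Gx; case: z => n; first exact: partial_characterMn.
rewrite NegzE mulrNz -sub0r; case: (pG) => G0 GB _; apply: GB => //.
exact: (partial_characterMn n.+1).
Qed.

Definition extend_by (G : V * ratZ -> Prop) (x y : V * ratZ) :=
  exists2 w, G w & exists z : int, y = w + x *~ z.

Lemma pairMz (v : V) (e : ratZ) (z : int) : (v, e) *~ z = (v *~ z, e *~ z).
Proof.
by rewrite [LHS]surjective_pairing (raddfMz fst) (raddfMz snd).
Qed.

(** Baer's argument for one more element: if [m] is the least positive integer with [v *+ m] in the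
    domain, the value there is divided by [m]; division with remainder shows that every multiple of
    [v] in the domain is a multiple of [v *+ m]. Without such an [m], the value 0 will do. *)
Lemma extend_byP G (v : V) : partial_character G ->
  exists e, partial_character (extend_by G (v, e)).
Proof.
move=> pG; have [G0 GB Gf] := pG.
have GN w e : G (w, e) -> G (- w, - e).
  by move=> Gw; rewrite -(sub0r w) -(sub0r e); exact: (GB 0 (w, e)).
have GD w e w' e' : G (w, e) -> G (w', e') -> G (w - w', e - e').
  exact: (GB (w, e) (w', e')).
have Guniq w e e' : G (w, e) -> G (w, e') -> e = e'.
  by move=> Ge Ge'; apply/subr0_eq/Gf; rewrite -(subrr w); exact: (GB (w,
    e) (w, e')).
suff [e eP] : exists e, forall (z : int) e', G (v *~ z, e') -> e' = e *~ z.
  exists e; split.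
  - by exists 0 => //; exists 0; rewrite mulr0z addr0.
  - move=> _ _ [w Gw [z ->]] [w' Gw' [z' ->]]; exists (w - w'); first exact: GB.
    by exists (z - z'); rewrite mulrzBr opprD addrACA.
  - move=> e0 [[w ew] Gw [z]]; rewrite pairMz => -[/esym/eqP].
    rewrite addr_eq0 => /eqP wE ->.
    by move/GN: Gw; rewrite wE opprK => /eP <-; rewrite subrr.
have [[d [d0 [e0 Gd]]]|noG] :=
  pselect (exists d : nat, (0 < d)%N /\ exists e, G (v *+ d, e)); last first.
  exists 0 => z e' Gz; rewrite mul0rz.
  case: z Gz => [[|n]|n] Gz; first by apply: Gf; exact: Gz.
    by case: noG; exists n.+1; split => //; exists e'.
  case: noG; exists n.+1; split => //; exists (- e').
  by move/GN: Gz; rewrite NegzE mulrNz opprK.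
have exd : exists d, `[< (0 < d)%N /\ exists e, G (v *+ d, e) >].
  by exists d; apply/asboolP; split=> //; exists e0.
case: (ex_minnP exd) => m /asboolP [m0 [em Gm]] mmin.
have [e eE] := ratZ_divisible em m0; exists e => z e' Gz.
have zE := divz_eq z m; move: zE; set q := (z %/ m)%Z; set r :=
  (z %% m)%Z => zE.
have r0 : 0 <= r by rewrite modz_ge0// gt_eqF.
have rm : r < m by rewrite ltz_pmod.
have Gr : G (v *~ r, e' - em *~ q).
  have := partial_characterMz q pG Gm; rewrite pairMz => /(GD _ _ _ _ Gz).
  by rewrite {1}zE mulrzDr mulrC mulrzA addrAC subrr add0r.
have rE : r = 0.
  apply/eqP; rewrite eq_le r0 andbT leNgt; apply/negP => r_gt0.
  move: Gr rm r_gt0; case: r {r0 zE} => // k Gr; rewrite !ltz_nat => km k0.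
  have: (m <= k)%N; last by rewrite leqNgt km.
  by apply: mmin; apply/asboolP; split=> //; exists (e' - em *~ q).
move: Gr; rewrite rE mulr0z => /Gf/subr0_eq ->.
by rewrite zE rE addr0 -eE mulrC mulrzA.
Qed.

(** By Zorn's lemma there is a maximal graph above [G]; [extend_byP] makes its domain all of [V]. *)
Lemma character_extension G : partial_character G ->
  exists f : {additive V -> ratZ}, forall v e, G (v, e) -> f v = e.
Proof.
move=> pG.
pose T := {H : V * ratZ -> Prop | partial_character H /\ forall x, G x -> H x}.
pose leT (H K : T) := `[< forall x, sval H x -> sval K x >].
have [| | |H maxH] := @ZL_preorder T (exist _ G (conj pG (fun=> id))) leT.
- by move=> H; apply/asboolP.
- by move=> H K L /asboolP HK /asboolP KL; apply/asboolP => x /HK/KL.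
- move=> A Atot; have [[H0 AH0]|A0] := pselect (exists H, A H); last first.
    exists (exist _ G (conj pG (fun=> id))) => H AH; case: A0; by exists H.
  pose U x := exists2 H, A H & sval H x.
  have pU : partial_character U /\ forall x, G x -> U x.
    split; last by move=> x Gx; exists H0 => //; case: (svalP H0) => _; exact.
    split.
    - by exists H0 => //; case: (svalP H0) => [[]].
    - move=> x y [H AH Hx] [K AK Ky].
      have [/asboolP HK|/asboolP KH] := Atot _ _ AH AK.
        by exists K => //; case: (svalP K) => [[_ B _] _]; apply: B => //;
          exact: HK.
      by exists H => //; case: (svalP H) => [[_ B _] _]; apply: B => //;
        exact: KH.
    - by move=> e [H AH He]; case: (svalP H) => [[_ _ B] _]; exact: B.
  by exists (exist _ U pU) => H AH; apply/asboolP => x Hx; exists H.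
have [pH GH] := svalP H; have [H0 HB Hf] := pH.
have Huniq w e e' : sval H (w, e) -> sval H (w, e') -> e = e'.
  by move=> He He'; apply/subr0_eq/Hf; rewrite -(subrr w); exact: (HB (w,
    e) (w, e')).
have Htot v : exists e, sval H (v, e).
  have [e pK] := extend_byP v pH; exists e.
  have HK x : sval H x -> extend_by (sval H) (v, e) x.
    by exists x => //; exists 0; rewrite mulr0z addr0.
  pose K : T := exist _ (extend_by (sval H) (v, e))
    (conj pK (fun x Gx => HK x (GH x Gx))).
  have /asboolP /(_ (v, e)) : leT K H by apply: maxH; apply/asboolP.
  by apply; exists 0 => //; exists 1; rewrite add0r mulr1z.
pose f v := sval (cid (Htot v)); have fP v : sval H (v, f v) :=
  svalP (cid (Htot v)).
have fB : zmod_morphism f by move=> x y;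
  exact: Huniq (fP _) (HB _ _ (fP x) (fP y)).
exists (additive_of fB) => v e /GH He.
exact: Huniq (fP v) He.
Qed.

Lemma character_separation (v : V) : v <> 0 ->
  exists f : {additive V -> ratZ}, f v <> 0.
Proof.
move=> v0; suff [e [e0 eP]] : exists e : ratZ, e <> 0 /\ forall z : int,
  v *~ z = 0 -> e *~ z = 0.
  have [f fP] : exists f : {additive V -> ratZ}, forall w e',
      (exists z : int, (w, e') = (v, e) *~ z) -> f w = e'.
    apply: (@character_extension (fun y => exists z : int, y = (v, e) *~ z)).
    split; first by exists 0; rewrite mulr0z.
      by move=> _ _ [z ->] [z' ->]; exists (z - z'); rewrite mulrzBr.
    by move=> e' [z]; rewrite pairMz => -[/esym/eP ez ->].
  by exists f; rewrite (fP v e)//; exists 1; rewrite mulr1z.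
have [[d [d0 vd]]|nod] := pselect (exists d : nat, (0 < d)%N /\ v *+ d = 0).
  have exd : exists d, (0 < d)%N && (v *+ d == 0).
    by exists d; rewrite d0 vd eqxx.
  case: (ex_minnP exd) => m /andP[m0 /eqP vm] mmin.
  have m1 : (1 < m)%N.
    by case: m m0 vm {mmin} => [|[|m]]// _; rewrite mulr1n.
  have [e [e0 em]] := ratZ_torsion m1; exists e; split=> // z vz.
  have zE := divz_eq z m; move: zE; set q := (z %/ m)%Z; set r :=
    (z %% m)%Z => zE.
  have r0 : 0 <= r by rewrite modz_ge0// gt_eqF.
  have rm : r < m by rewrite ltz_pmod.
  have vr : v *~ r = 0.
    by move: vz; rewrite zE mulrzDr [q * _]mulrC mulrzA -pmulrn vm mul0rz add0r.
  suff rE : r = 0 by rewrite zE rE addr0 [q * _]mulrC mulrzA -pmulrn em mul0rz.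
  apply/eqP; rewrite eq_le r0 andbT leNgt; apply/negP => r_gt0.
  move: vr rm r_gt0; case: r {r0 zE} => // k vk; rewrite !ltz_nat => km k0.
  have: (m <= k)%N; last by rewrite leqNgt km.
  by apply: mmin; rewrite k0; apply/eqP.
(* If [v] has infinite order, any nonzero value is allowed; a nonzero element of order 2 is at
   hand. *)
have [e [e0 _]] := ratZ_torsion (ltnSn 1); exists e; split=> // z vz.
case: z vz => [[|n]|n] vz; first by rewrite mulr0z.
  by case: nod; exists n.+1.
case: nod; exists n.+1; split=> //; apply/eqP.
by move/eqP: vz; rewrite NegzE mulrNz oppr_eq0.
Qed.

End CharacterExtension.

(** * Modules with linear limits along filters *)

Section LinearFactorization.
Variables (R : pzRingType) (U V W : lmodType R).

Lemma factor_surjective (p : {linear U -> V}) (g : {linear U -> W}) :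
  (forall v, exists u, p u = v) -> (forall u, p u = 0 -> g u = 0) ->
  exists h : {linear V -> W}, forall u, h (p u) = g u.
Proof.
move=> ps pg; pose s v := sval (cid (ps v)).
have sP v : p (s v) = v := svalP (cid (ps v)).
have gE u : g (s (p u)) = g u.
  by apply/subr0_eq; rewrite -linearB pg// linearB sP subrr.
have hL : linear (g \o s).
  by move=> a x y /=; rewrite -[x in LHS]sP -[y in LHS]sP -!linearP gE.
by exists (linear_of hL) => u; exact: gE.
Qed.

Lemma factor_injective (m : {linear U -> V}) (g : {linear W -> V}) :
  injective m -> (forall w, exists u, m u = g w) ->
  exists h : {linear W -> U}, forall w, m (h w) = g w.
Proof.
move=> mi gm; pose s w := sval (cid (gm w)).
have sP w : m (s w) = g w := svalP (cid (gm w)).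
have sL : linear s by move=> a x y; apply: mi; rewrite linearP !sP linearP.
by exists (linear_of sL).
Qed.

End LinearFactorization.

Lemma linear_inj (R : pzRingType) (U V : lmodType R) (f : {linear U -> V}) :
  (forall x, f x = 0 -> x = 0) -> injective f.
Proof. by move=> f0 x y fxy; apply/subr0_eq/f0; rewrite linearB fxy subrr. Qed.

Lemma pi_Cok_eq0 (R : pzRingType) (U V : lmodType R) (f : {linear U -> V}) y :
  pi_Cok f y = 0 <-> exists x, f x = y.
Proof. exact: lcokpi_eq0. Qed.

Lemma pi_Cok_im (R : pzRingType) (U V : lmodType R) (f : {linear U -> V}) x :
  pi_Cok f (f x) = 0.
Proof. by apply/pi_Cok_eq0; exists x. Qed.

Lemma pi_Cok_onto (R : pzRingType) (U V : lmodType R) (f : {linear U -> V})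
  (c : Cok f) : exists y, pi_Cok f y = c.
Proof. by exists (lcokrepr c); exact: lcokreprK. Qed.

Section RowMap.
Variables (R : pzRingType) (M : lmodType R) (n : nat) (c : 'I_n -> M).

Definition row_map (v : 'rV[R]_n) : M := \sum_j v ord0 j *: c j.

Lemma row_map_linear : linear row_map.
Proof.
move=> a u v; rewrite /row_map scaler_sumr -big_split; apply: eq_bigr => j _.
by rewrite !mxE scalerDl scalerA.
Qed.

HB.instance Definition _ :=
  GRing.isLinear.Build R 'rV[R]_n M *:%R row_map row_map_linear.

Lemma row_map_delta j : row_map (delta_mx 0 j) = c j.
Proof.
rewrite /row_map (bigD1 j)//= mxE !eqxx scale1r big1 ?addr0// => i ij.
by rewrite mxE (negPf ij) andbF scale0r.
Qed.

End RowMap.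

Lemma linear_row_ext (R : pzRingType) (M : lmodType R) n
    (f g : {linear 'rV[R]_n -> M}) :
  (forall j, f (delta_mx 0 j) = g (delta_mx 0 j)) -> f =1 g.
Proof.
move=> fg v; rewrite (matrix_sum_delta v) big_ord1 !linear_sum.
by apply: eq_bigr => j _; rewrite !linearZ /= fg.
Qed.

(** A form of algebraic compactness: along a filter built from finite subsystems, the limit of their
    solutions solves a whole linear system. Apart from linearity, [lim] is constrained only on
    functions that are constant on a set of the filter. *)
Definition has_limits (R : pzRingType) (X : lmodType R) : Prop :=
  forall (I : Type) (F : set_system I), ProperFilter F ->
  exists lim : (I -> X) -> X,
    (forall a u v, lim (fun i => a *: u i + v i) = a *: lim u + lim v) /\
    (forall u x, F [set i | u i = x]%classic -> lim u = x).

(** The eventual value is a partial character of the power of Q/Z: intersections in [F] give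
    additivity, and properness makes it single-valued. *)
Lemma ratZ_limits (I : Type) (F : set_system I) : ProperFilter F ->
  exists lim : {additive (I -> ratZ) -> ratZ},
    forall u e, F [set i | u i = e]%classic -> lim u = e.
Proof.
move=> PF.
apply: (@character_extension _ (fun y => F [set i | y.1 i = y.2]%classic)).
split.
- by apply: filterS filterT.
- move=> x y Fx Fy; apply: filterS (filterI Fx Fy) => i [/= <- <-].
  by [].
- by move=> e /filter_ex[i /= <-].
Qed.

Section Characters.
Variable U : zmodType.

Definition chargroup : Type := {additive U -> ratZ}.
HB.instance Definition _ := gen_eqMixin chargroup.
HB.instance Definition _ := gen_choiceMixin chargroup.
HB.instance Definition _ := GRing.isZmodule.Build chargroup
  (@homDA Ab U ratZ) (@homDC Ab U ratZ) (@hom0D Ab U ratZ) (@homND Ab U ratZ).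

End Characters.

Section DoubleDual.
Variables (R : pzRingType) (M : lmodType R).

Definition char_app (U : zmodType) (x : chargroup U) : {additive U -> ratZ} :=
  x.

(** The right action of [R] on characters, kept as bare additive maps; the double dual is then again
    a left module. *)
Definition char_scale (r : R) (x : chargroup M) : chargroup M :=
  (char_app x \o *:%R r : M -> ratZ) : {additive M -> ratZ}.

Lemma char_scale_zmod_morphism r : zmod_morphism (char_scale r).
Proof. by move=> x y; exact: additive_ext. Qed.
HB.instance Definition _ r := GRing.isZmodMorphism.Build
  (chargroup M) (chargroup M) (char_scale r) (char_scale_zmod_morphism r).

Definition dual2 : Type := chargroup (chargroup M).
HB.instance Definition _ := GRing.Zmodule.on dual2.

Definition dual2_scale (r : R) (y : dual2) : dual2 :=
  (char_app y \o char_scale r : chargroup M -> ratZ) : {additive _ -> _}.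

Lemma dual2_scaleA a b y : dual2_scale a (dual2_scale b y) = dual2_scale (a *
  b) y.
Proof.
apply: additive_ext => x; apply: (congr1 (char_app y)).
by apply: additive_ext => z; apply: (congr1 (char_app x)); exact: scalerA.
Qed.
Lemma dual2_scale1 : left_id 1 dual2_scale.
Proof.
move=> y; apply: additive_ext => x; apply: (congr1 (char_app y)).
by apply: additive_ext => z; apply: (congr1 (char_app x)); exact: scale1r.
Qed.
Lemma dual2_scaleDr : right_distributive dual2_scale +%R.
Proof. by move=> a y z; exact: additive_ext. Qed.
Lemma dual2_scaleDl y : {morph dual2_scale^~ y : a b / a + b}.
Proof.
move=> a b; apply: additive_ext => x.
apply: etrans (raddfD (char_app y) _ _); apply: (congr1 (char_app y)).
apply: additive_ext => z; apply: etrans (raddfD (char_app x) _ _).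
by apply: (congr1 (char_app x)); exact: scalerDl.
Qed.
HB.instance Definition _ := GRing.Zmodule_isLmodule.Build R dual2
  dual2_scaleA dual2_scale1 dual2_scaleDr dual2_scaleDl.

Lemma dual2_ext (y z : dual2) : (forall x, char_app y x = char_app z x) ->
  y = z.
Proof. exact: additive_ext. Qed.

Lemma dual2_sumE (J : Type) (s : seq J) (F : J -> dual2) x :
  char_app (\sum_(j <- s) F j) x = \sum_(j <- s) char_app (F j) x.
Proof. by elim/big_rec2: _ => // j a b _ <-. Qed.

Definition to_dual2 (m : M) : dual2 :=
  additive_of (fun x y => erefl : char_app (x - y) m = char_app x m - char_app
    y m).

Lemma to_dual2_linear : linear to_dual2.
Proof.
by move=> a x y; apply: dual2_ext => c;
  rewrite /= /to_dual2 (raddfD (char_app c)).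
Qed.
HB.instance Definition _ :=
  GRing.isLinear.Build R M dual2 *:%R to_dual2 to_dual2_linear.

(** The limit is taken separately at each character. It is linear over [R] because a scalar acts by
    moving the evaluation to another character. *)
Lemma dual2_limits : has_limits (dual2 : lmodType R).
Proof.
move=> I F PF; have [lim limP] := ratZ_limits PF.
have limB (u : I -> dual2) :
    zmod_morphism (fun x : chargroup M => lim (fun i => char_app (u i) x)).
  move=> x y; rewrite -raddfB; congr (lim _); apply/funext => i.
  exact: (raddfB (char_app (u i))).
exists (fun u => additive_of (limB u)); split=> [a u v|u y Fu].
  by apply: dual2_ext => x; exact: (raddfD lim).
apply: dual2_ext => x; apply: limP.
by apply: filterS Fu => i /= ->.
Qed.

End DoubleDual.

(** * Purity of a module in its double dual *)

Lemma chargroup_sumE (U : zmodType) (J : Type) (s : seq J)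
    (F : J -> chargroup U) x :
  char_app (\sum_(j <- s) F j) x = \sum_(j <- s) char_app (F j) x.
Proof. by elim/big_rec2: _ => // j a b _ <-. Qed.

(* A character of M^m that vanishes on the image of M^n is a tuple of m       *)
(* characters of M; a solution over the double dual is evaluated at it.       *)
Lemma dual2_solve (R : pzRingType) (M : lmodType R) m n
    (a : 'I_m -> 'rV[R]_n) (y : 'I_n -> dual2 M) (b : 'I_m -> M) :
  (forall i, row_map y (a i) = to_dual2 (b i)) ->
  exists z : 'I_n -> M, forall i, row_map z (a i) = b i.
Proof.
move=> ayb.
pose T (z : 'I_n -> M) : 'I_m -> M := fun i => row_map z (a i).
have TB : zmod_morphism T.
  move=> z z'; apply/funext => i; rewrite /T /row_map -[RHS]sumrB.
  by apply: eq_bigr => j _; rewrite -scalerBr.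
(* Solvability means that [b] dies in the cokernel of [T]; otherwise a character of that cokernel
   detects it. *)
suff : cokpi (additive_of TB) b = 0.
  by move/cokpi_eq0 => [z zb]; exists z => i; exact: (congr1 (@^~ i) zb).
apply: contrapT => /character_separation [f]; apply.
pose d k (i : 'I_k) (x : M) : 'I_k -> M := fun i' => if i' == i then x else 0.
have dB k (i : 'I_k) : zmod_morphism (d k i).
  move=> x x'; apply/funext => i'.
  change (d k i (x - x') i' = d k i x i' - d k i x' i').
  by rewrite /d; case: ifP; rewrite ?subr0.
have dE k (w : 'I_k -> M) : w = \sum_i d k i (w i).
  apply/funext => i; rewrite fct_sumE (bigD1 i)//= /d eqxx big1 ?addr0// => i'.
  by rewrite eq_sym => /negPf ->.
have phiB i : zmod_morphism (fun x => f (cokpi (additive_of TB) (d m i x))).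
  by move=> x x'; rewrite dB !raddfB.
pose phi i : chargroup M := additive_of (phiB i).
have phi_sum w : f (cokpi _ w) = \sum_i char_app (phi i) (w i).
  by rewrite {1}(dE _ w) !raddf_sum.
(* The character kills the image of [T]; tuples supported at coordinate [j] turn this into a
   relation among the [phi i]. *)
have phi0 j : \sum_i char_scale (a i ord0 j) (phi i) = 0.
  apply: additive_ext => x; apply: etrans (chargroup_sumE _ _ _) _.
  transitivity (f (cokpi (additive_of TB) (T (d n j x)))); last first.
    by rewrite -[RHS](raddf0 f); congr (f _); apply/cokpi_eq0; exists (d n j x).
  rewrite phi_sum; apply: eq_bigr => i _; apply: (congr1 (char_app (phi i))).
  rewrite /T /row_map (bigD1 j)//= /d eqxx big1 ?addr0// => j' /negPf ->.
  by rewrite scaler0.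
rewrite phi_sum.
transitivity (\sum_i \sum_j char_app (y j) (char_scale (a i ord0 j) (phi i))).
  apply: eq_bigr => i _; rewrite -[LHS]/(char_app (to_dual2 (b i)) (phi i)).
  by rewrite -ayb dual2_sumE.
rewrite exchange_big big1// => j _.
by rewrite -[LHS](raddf_sum (char_app (y j))) phi0 raddf0.
Qed.

Lemma row_map_comp (R : pzRingType) (M N : lmodType R) n (g : {linear M -> N})
  (c : 'I_n -> M) v : row_map (g \o c) v = g (row_map c v).
Proof.
by rewrite [RHS]linear_sum; apply: eq_bigr => j _; rewrite linearZ_LR.
Qed.

Lemma fp_lift_generators (R : pzRingType) (M B C : lmodType R) m n
    (q : {linear 'rV[R]_m -> 'rV[R]_n}) (p : {linear 'rV[R]_n -> M})
    (g : {linear B -> C}) (h : {linear M -> C}) (y : 'I_n -> B) :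
  (forall x, exists v, p v = x) -> (forall v, p v = 0 <-> exists w, q w = v) ->
  (forall j, g (y j) = h (p (delta_mx 0 j))) ->
  (forall i, row_map y (q (delta_mx 0 i)) = 0) ->
  exists k : {linear M -> B}, forall x, g (k x) = h x.
Proof.
move=> ps pq gy yq; have [|k kE] := factor_surjective (p := p) (g :=
  row_map y) ps.
  move=> _ /pq[w <-].
  have := @linear_row_ext _ _ _ (row_map y \o q) (\0 : 'rV[R]_m -> B).
  by apply=> j /=; rewrite yq.
exists k => x; have [v <-] := ps x; rewrite kE.
have := @linear_row_ext _ _ _ (g \o row_map y) (h \o p).
by apply=> j /=; rewrite row_map_delta.
Qed.

(** Injectivity is [character_separation]. For purity, arbitrary lifts [y j] of the generators break
    the relations by elements [b i] of [M]; [dual2_solve] finds [z] in [M] with the same defects,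
    and [y - z] satisfies the relations. *)
Lemma to_dual2_pure (R : pzRingType) (M : lmodType R) :
  pure_mono (to_dual2 (M := M)).
Proof.
split.
  apply: linear_inj => x x0; apply: contrapT => /character_separation [f];
    apply.
  exact: (congr1 (fun y => char_app y (f : chargroup M)) x0).
move=> N h [m [n [q [p [ps pq]]]]].
have yP j := pi_Cok_onto (h (p (delta_mx 0 j))).
pose y j := sval (cid (yP j)).
have yE j : pi_Cok _ (y j) = h (p (delta_mx 0 j)) := svalP (cid (yP j)).
have bP i : exists b, to_dual2 b = row_map y (q (delta_mx 0 i)).
  apply/pi_Cok_eq0.
  have -> v : pi_Cok (to_dual2 (M:=M)) (row_map y v) = h (p v).
    have := @linear_row_ext _ _ _ (pi_Cok _ \o row_map y) (h \o p).
    by apply=> j /=; rewrite row_map_delta; exact: yE.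
  by have -> : p (q (delta_mx 0 i)) = 0 by [apply/pq; exists (delta_mx 0 i)];
    rewrite linear0.
pose b i := sval (cid (bP i)).
have bE i : to_dual2 (b i) = row_map y (q (delta_mx 0 i)) := svalP (cid (bP i)).
have [z zE] := dual2_solve (fun i => esym (bE i)).
apply: (fp_lift_generators (y := fun j => y j - to_dual2 (z j)) ps pq) => [j|i].
  by rewrite linearB pi_Cok_im subr0.
transitivity (row_map y (q (delta_mx 0 i)) - row_map (to_dual2 (M:=M) \o z) (q
  (delta_mx 0 i))).
  rewrite /row_map -sumrB; apply: eq_bigr => j _; exact: scalerBr.
rewrite row_map_comp zE; apply/eqP; rewrite subr_eq0; apply/eqP;
  exact: (esym (bE i)).
Qed.

(** * Lifting along local lifts *)

Lemma Cok_finitely_presented (R : pzRingType) m n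
    (q : {linear 'rV[R]_m -> 'rV[R]_n}) : finitely_presented (Cok q).
Proof.
exists m, n, q, (pi_Cok q); split=> [y|v]; first exact: pi_Cok_onto.
exact: pi_Cok_eq0.
Qed.

(* Every module is a filtered colimit of finitely presented ones: finitely    *)
(* many linear relations of L already hold in a finitely presented M over L.  *)
Lemma finite_approximation (R : pzRingType) (L : lmodType R)
    (T : seq (R * L * L)) :
  exists (M : lmodType R) (p : {linear M -> L}) (e : L -> M),
    finitely_presented M /\
    forall r b b', (r, b, b') \in T ->
      [/\ p (e b) = b, p (e b') = b', p (e (r *: b + b')) = r *: b + b' &
          e (r *: b + b') = r *: e b + e b'].
Proof.
pose C := undup (flatten [seq [:: t.1.2; t.2; t.1.1 *: t.1.2 + t.2] | t <- T]).
(* The value 0 outside [C] is harmless: [C] contains every element that the triples of [T]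
   mention. *)
pose E (b : L) : 'rV[R]_(size C) :=
  if insub (index b C) is Some j then delta_mx 0 j else 0.
pose g : {linear 'rV[R]_(size C) -> L} :=
  row_map (fun j : 'I_(size C) => nth 0 C j).
have gD j : g (delta_mx 0 j) = nth 0 C j := row_map_delta _ j.
have gE b : b \in C -> g (E b) = b.
  move=> bC; rewrite /E insubT ?index_mem// => ltC.
  by rewrite gD /= nth_index.
have TC r b b' : (r, b, b') \in T -> [/\ b \in C, b' \in C & r *: b + b' \in C].
  move=> tT; have sub x : x \in [:: b; b'; r *: b + b'] -> x \in C.
    by move=> xt; rewrite mem_undup; apply/flatten_mapP; exists (r, b, b').
  by split; apply: sub; rewrite !inE eqxx ?orbT.
pose q : {linear 'rV[R]_(size T) -> 'rV[R]_(size C)} :=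
  row_map (fun i : 'I_(size T) =>
  let t := nth (0, 0, 0) T i in
  E (t.1.1 *: t.1.2 + t.2) - (t.1.1 *: E t.1.2 + E t.2)).
have qD i := row_map_delta _ i : q (delta_mx 0 i) = _.
have [|p pE] := factor_surjective (p := pi_Cok q) (g :=
  g) (@pi_Cok_onto _ _ _ _).
  move=> _ /pi_Cok_eq0[w <-].
  have := @linear_row_ext _ _ _ (g \o q) (\0 : 'rV[R]_(size T) -> L); apply.
  move=> i /=; rewrite qD.
  have := mem_nth (0, 0, 0) (ltn_ord i); case: (nth _ _ _) => [[r b] b'] /=.
  by move=> /TC[Cb Cb' Cr]; rewrite linearB linearD linearZ_LR !gE// subrr.
exists (Cok q), p, (fun b => pi_Cok q (E b)); split.
  exact: Cok_finitely_presented.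
move=> r b b' tT; have [Cb Cb' Cr] := TC _ _ _ tT.
split; rewrite ?pE ?gE//; rewrite -linearP.
apply/subr0_eq; rewrite -linearB; apply/pi_Cok_eq0.
have ti : (index (r, b, b') T < size T)%N by rewrite index_mem.
by exists (delta_mx 0 (Ordinal ti)); rewrite qD /= nth_index.
Qed.

(** Fix a set-theoretic lift [t] of [u] and correct it by [f \o x] with [x : L -> X]. For finitely
    many linear relations a local lift provides a suitable [x]; the limit of these corrections
    respects all relations at once. *)
Lemma lift_of_local_lifts (R : pzRingType) (X Y L : lmodType R)
    (f : {linear X -> Y}) (u : {linear L -> Cok f}) :
  has_limits X -> injective f ->
  (forall (M : lmodType R) (s : {linear M -> L}), finitely_presented M ->
     exists k : {linear M -> Y}, forall x, pi_Cok f (k x) = u (s x)) ->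
  exists w : {linear L -> Y}, forall x, pi_Cok f (w x) = u x.
Proof.
move=> limX fi loc.
pose t b := sval (cid (pi_Cok_onto (u b))).
have tE b : pi_Cok f (t b) = u b := svalP (cid (pi_Cok_onto (u b))).
pose lift (x : L -> X) b := t b + f (x b).
pose B (T : seq (R * L * L)) : set (L -> X) := [set x | forall r b b',
  (r, b, b') \in T -> lift x (r *: b + b') = r *: lift x b + lift x b']%classic.
have B0 T : exists x, B T x.
  have [M [p [e [fpM eP]]]] := finite_approximation T.
  have [k kE] := loc M p fpM.
  have xP b : exists x, p (e b) = b -> f x = k (e b) - t b.
    have [pe|pe] := pselect (p (e b) = b); last by exists 0.
    have /pi_Cok_eq0[x xE] : pi_Cok f (k (e b) - t b) = 0.
      by rewrite linearB kE tE pe subrr.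
    by exists x.
  exists (fun b => sval (cid (xP b))) => r b b' /eP[pb pb' pr er].
  have lE c : p (e c) = c -> lift (fun b => sval (cid (xP b))) c = k (e c).
    by move=> pc; rewrite /lift (svalP (cid (xP c)) pc) addrC subrK.
  by rewrite !lE// er linearP.
(* The filter lives on the corrections themselves, so [lim (@^~ b)] is the value at [b] of a
   limiting correction. *)
pose F := filter_from setT B.
have PF : ProperFilter F.
  apply: filter_from_proper; last by move=> T _; exact: B0.
  apply: filter_fromT_filter; first by exists [::].
  move=> S T; exists (S ++ T) => x Bx; split=> r b b' tT; apply: Bx.
    by rewrite mem_cat tT.
  by rewrite mem_cat tT orbT.
have [lim [limP limC]] := limX _ F PF.
pose w b := lift (fun b => lim (@^~ b)) b.
have wL : linear w.
  move=> r b b'.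
  (* Respecting this relation forces [x (r *: b + b') - r *: x b - x b'] to be the constant [d], an
     equation that [lim] preserves. *)
  have [d dE] : exists d, f d = r *: t b + t b' - t (r *: b + b').
    apply/pi_Cok_eq0; rewrite linearB linearP !tE linearP; exact: subrr.
  have limD : lim (fun x => (-r) *: x b + ((-1) *: x b' + x (r *: b + b'))) = d.
    apply: limC; exists [:: (r, b, b')] => // x /(_ r b b').
    rewrite inE eqxx => /(_ isT); rewrite /lift => xE /=.
    apply: fi; rewrite dE !linearP scaleN1r scaleNr.
    have -> : f (x (r *: b + b')) =
        r *: (t b + f (x b)) + (t b' + f (x b')) - t (r *: b + b').
      by rewrite -xE addrAC subrr add0r.
    rewrite scalerDr addrACA addrA -opprD [X in _ + (X - _)]addrC.
    by rewrite -[X in _ + X]addrA addKr.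
  have l3 : lim (@^~ (r *: b + b')) = r *: lim (@^~ b) + lim (@^~ b') + d.
    have solve (x y z e : X) : - x + (- y + z) = e -> z = x + y + e.
      by move=> <-; rewrite [X in _ + X]addrA -opprD addNKr.
    by move: limD; rewrite !limP scaleN1r scaleNr => /solve.
  rewrite /w /lift l3 !linearD linearZ_LR dE [LHS]addrC addrA subrK.
  by rewrite scalerDr addrC addrACA.
exists (linear_of wL) => b.
by rewrite -[linear_of wL b]/(t b + f _) linearD pi_Cok_im addr0.
Qed.

(** * Pure-injective modules *)

Section Kernel.
Variables (R : pzRingType) (U V : lmodType R) (d : {linear U -> V}).

Definition ker : {pred U} := [pred x | d x == 0].

Lemma ker_submod_closed : submod_closed ker.
Proof.
split=> [|a x y]; rewrite !inE; first by rewrite linear0.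
by move=> /eqP dx /eqP dy; rewrite linearP dx dy scaler0 addr0.
Qed.
HB.instance Definition _ :=
  GRing.isSubmodClosed.Build R U ker ker_submod_closed.

Definition kernel : Type := {x | x \in ker}.
HB.instance Definition _ := SubType.on kernel.
HB.instance Definition _ := [Choice of kernel by <:].
HB.instance Definition _ := [SubChoice_isSubLmodule of kernel by <:].

Definition ker_incl : {linear kernel -> U} := val.

Lemma ker_incl_inj : injective ker_incl.
Proof. exact: val_inj. Qed.

Lemma ker_incl_im x : d x = 0 <-> exists k, ker_incl k = x.
Proof.
split=> [/eqP dx|[k <-]]; last by apply/eqP; exact: (valP k).
by exists (exist _ x dx).
Qed.

End Kernel.

(** The cokernel of [(h, - f)], described by elements. The third clause gives injectivity of [i]
    from that of [f], and of [j] from that of [h]. *)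
Lemma pushout (R : pzRingType) (A B X : lmodType R)
    (f : {linear A -> B}) (h : {linear A -> X}) :
  exists (Q : lmodType R) (i : {linear X -> Q}) (j : {linear B -> Q}),
  [/\ forall a, i (h a) = j (f a),
      forall y, exists x b, y = i x + j b,
      forall x b, i x + j b = 0 -> exists a, x = h a /\ b = - f a &
      forall (C : lmodType R) (u : {linear X -> C}) (v : {linear B -> C}),
        (forall a, u (h a) = v (f a)) ->
        exists w : {linear Q -> C}, (forall x, w (i x) = u x) /\
                                    (forall b, w (j b) = v b)].
Proof.
have gL : linear (fun a => (h a, - f a) : X * B).
  by move=> r x y; rewrite (linearP h) (linearP f) opprD -scalerN.
pose g := linear_of gL; pose p := pi_Cok g.
have iL : linear (fun x => p (x, 0)).
  by move=> a x y; rewrite -linearP; congr (p (_, _)); rewrite /= scaler0 addr0.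
have jL : linear (fun b => p (0, b)).
  by move=> a x y; rewrite -linearP; congr (p (_, _)); rewrite /= scaler0 addr0.
have pE x b : p (x, 0) + p (0, b) = p (x, b).
  by rewrite -linearD; congr (p (_, _)); rewrite /= ?addr0 ?add0r.
exists (Cok g), (linear_of iL), (linear_of jL); split.
- move=> a; change (p (h a, 0) = p (0, f a)).
  apply/subr0_eq; rewrite -linearB; apply/pi_Cok_eq0.
  by exists a; congr pair; rewrite /= ?subr0 ?sub0r.
- move=> y; have [[x b] <-] := pi_Cok_onto y; exists x, b; exact/esym/pE.
- move=> x b /(etrans (esym (pE x b)))/pi_Cok_eq0[a [<- <-]].
  by exists a.
- move=> C u v uv.
  have wL : linear (fun y => u y.1 + v y.2).
    by move=> a x y /=; rewrite !linearP scalerDr addrACA.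
  have [|w wE] := factor_surjective (p := p) (g :=
    linear_of wL) (@pi_Cok_onto _ _ _ _).
    by move=> _ /pi_Cok_eq0[a <-]; rewrite /= uv linearN subrr.
  by exists w; split=> [x|b]; rewrite wE /= ?linear0 ?addr0 ?add0r.
Qed.

(** Push [f] out along [h]. By purity, [Cok f -> Cok i] lifts to [Q] locally, hence globally by some
    [w]; then [j - w pi] lands in [X] and extends [h]. *)
Lemma limits_pure_injective (R : pzRingType) (X : lmodType R) :
  has_limits X -> pure_injective X.
Proof.
move=> limX A B f h [fi fpure].
have [Q [i [j [ij _ ij0 _]]]] := pushout f h.
have ii : injective i.
  apply: linear_inj => x ix; have := ij0 x 0.
  rewrite linear0 addr0 => /(_ ix)[a [-> /esym/eqP]].
  by rewrite oppr_eq0 => /eqP; rewrite -[0](linear0 f) => /fi ->;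
    rewrite linear0.
have [|u uE] := factor_surjective (p := pi_Cok f) (g := pi_Cok i \o j)
    (@pi_Cok_onto _ _ _ _).
  by move=> _ /pi_Cok_eq0[a <-]; rewrite /= -ij; exact: pi_Cok_im.
have [|w wE] := lift_of_local_lifts (u := u) limX ii.
  move=> M s fpM; have [k kE] := fpure M s fpM.
  by exists (j \o k) => x; rewrite -kE uE.
have [|e eE] := factor_injective (g := j \- (w \o pi_Cok f)) ii.
  by move=> b; apply/pi_Cok_eq0; rewrite linearB wE /= uE subrr.
exists e => a; apply: ii; rewrite eE /= ij.
by rewrite [lcokpi f (f a)]pi_Cok_im linear0 subr0.
Qed.

Lemma dual2_pure_injective (R : pzRingType) (M : lmodType R) :
  pure_injective (dual2 M).
Proof. exact/limits_pure_injective/dual2_limits. Qed.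

(* A pure-injective module is a direct summand of its double dual. *)
Lemma pure_injective_limits (R : pzRingType) (X : lmodType R) :
  pure_injective X -> has_limits X.
Proof.
move=> piX I F PF.
have [r rE] := piX _ _ _ idfun (to_dual2_pure X).
have [lim [limP limC]] := @dual2_limits R X I F PF.
exists (fun u => r (lim (fun i => to_dual2 (u i)))); split=> [a u v|u x Fu].
  rewrite -linearP -limP; congr (r (lim _)); apply/funext => i; exact: linearP.
rewrite (limC _ (to_dual2 x)) ?rE//.
by apply: filterS Fu => i /= ->.
Qed.

Lemma pure_injective_prod (R : pzRingType) (X Y : lmodType R) :
  pure_injective X -> pure_injective Y -> pure_injective (X * Y)%type.
Proof.
move=> piX piY A B f h pf.
have [hX hXE] := piX _ _ _ (fst \o h) pf.
have [hY hYE] := piY _ _ _ (snd \o h) pf.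
have hL : linear (fun b => (hX b, hY b) : X * Y) by move=> a x y;
  rewrite !linearP.
exists (linear_of hL) => x; rewrite [RHS]surjective_pairing.
by congr pair; [exact: hXE|exact: hYE].
Qed.

(** * Direct sums *)

Section DirectSum.
Variables (R : pzRingType) (I : choiceType) (M : I -> lmodType R).

Record dsum : Type := Dsum {
  dsum_fun :> forall i, M i;
  dsum_fin : exists l : seq I, forall i, i \notin l -> dsum_fun i = 0
}.

Lemma dsum_ext (v w : dsum) : (forall i, v i = w i) -> v = w.
Proof.
case: v w => [v vP] [w wP] /= vw.
have {}vw : v = w by exact: functional_extensionality_dep.
by subst w; congr Dsum; exact: Prop_irrelevance.
Qed.

HB.instance Definition _ := gen_eqMixin dsum.
HB.instance Definition _ := gen_choiceMixin dsum.

Definition dsum0 : dsum.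
Proof. by exists (fun i => 0); exists [::]. Defined.

Definition dsumN (v : dsum) : dsum.
Proof.
exists (fun i => - v i); have [l vl] := dsum_fin v.
by exists l => i il; rewrite vl ?oppr0.
Defined.

Definition dsumD (v w : dsum) : dsum.
Proof.
exists (fun i => v i + w i).
have [l vl] := dsum_fin v; have [k wk] := dsum_fin w.
by exists (l ++ k) => i; rewrite mem_cat negb_or => /andP[/vl -> /wk ->];
  rewrite addr0.
Defined.

Definition dsumZ (a : R) (v : dsum) : dsum.
Proof.
exists (fun i => a *: v i); have [l vl] := dsum_fin v.
by exists l => i il; rewrite vl ?scaler0.
Defined.

Lemma dsumA : associative dsumD.
Proof. by move=> u v w; apply: dsum_ext => i; exact: addrA. Qed.
Lemma dsumC : commutative dsumD.
Proof. by move=> u v; apply: dsum_ext => i; exact: addrC. Qed.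
Lemma dsum0D : left_id dsum0 dsumD.
Proof. by move=> u; apply: dsum_ext => i; exact: add0r. Qed.
Lemma dsumND : left_inverse dsum0 dsumN dsumD.
Proof. by move=> u; apply: dsum_ext => i; exact: addNr. Qed.
HB.instance Definition _ := GRing.isZmodule.Build dsum dsumA dsumC dsum0D
  dsumND.

Lemma dsumZA a b v : dsumZ a (dsumZ b v) = dsumZ (a * b) v.
Proof. by apply: dsum_ext => i; exact: scalerA. Qed.
Lemma dsumZ1 : left_id 1 dsumZ.
Proof. by move=> v; apply: dsum_ext => i; exact: scale1r. Qed.
Lemma dsumZDr : right_distributive dsumZ +%R.
Proof. by move=> a u v; apply: dsum_ext => i; exact: scalerDr. Qed.
Lemma dsumZDl v : {morph dsumZ^~ v : a b / a + b}.
Proof. by move=> a b; apply: dsum_ext => i; exact: scalerDl. Qed.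
HB.instance Definition _ :=
  GRing.Zmodule_isLmodule.Build R dsum dsumZA dsumZ1 dsumZDr dsumZDl.

Definition dsum_pr i : {linear dsum -> M i} :=
  linear_of (fun a (v w : dsum) => erefl : (a *: v + w) i = a *: v i + w i).

Definition dsum_single i (x : M i) : dsum.
Proof.
exists (dfwith (fun j => 0 : M j) x); exists [:: i] => j.
by rewrite inE eq_sym => ij; rewrite dfwith_out.
Defined.

Lemma dsum_single_linear i : linear (@dsum_single i).
Proof.
move=> a x y; apply: dsum_ext => j.
change (dsum_single (a *: x + y) j = a *: dsum_single x j + dsum_single y j).
have [ij|ij] := eqVneq i j; last by rewrite /= !dfwith_out// scaler0 addr0.
by subst j; rewrite /= !dfwith_in.
Qed.

Definition dsum_in i : {linear M i -> dsum} :=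
  linear_of (@dsum_single_linear i).

Lemma dsum_pr_in i x : dsum_pr i (dsum_in i x) = x.
Proof. exact: dfwith_in. Qed.

Lemma dsum_pr_in_neq i j x : i != j -> dsum_pr j (dsum_in i x) = 0.
Proof. exact: dfwith_out. Qed.

Lemma dsum_decomp (l : seq I) (v : dsum) : uniq l ->
  (forall i, i \notin l -> v i = 0) ->
    v = \sum_(i <- l) dsum_in i (dsum_pr i v).
Proof.
move=> ul vl; apply: dsum_ext => j.
rewrite -[RHS]/(dsum_pr j _) linear_sum /=.
have [jl|jl] := boolP (j \in l).
  rewrite (bigD1_seq j)//= [dfwith _ _ _]dfwith_in big1 ?addr0// => i ij.
  exact: dfwith_out.
rewrite vl// big_seq big1// => i il; apply: dfwith_out.
by apply: contraNneq jl => <-.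
Qed.

Lemma fp_dsum_support (N : lmodType R) (s : {linear N -> dsum}) :
  finitely_presented N ->
  exists2 l : seq I, uniq l & forall i, i \notin l -> forall x, s x i = 0.
Proof.
move=> [m [n [q [p [ps _]]]]].
pose k j := sval (cid (dsum_fin (s (p (delta_mx 0 j))))).
have kP j i : i \notin k j -> s (p (delta_mx 0 j)) i = 0.
  by move: i; exact: (svalP (cid (dsum_fin _))).
exists (undup (flatten [seq k j | j <- enum 'I_n])); first exact: undup_uniq.
move=> i; rewrite mem_undup => il x; have [v <-] := ps x.
apply: (@linear_row_ext _ _ _ (dsum_pr i \o (s \o p)) (\0 : 'rV[R]_n ->
  M i)) => j.
apply: kP; apply: contra il => ij; apply/flatten_mapP; exists j => //.
by rewrite mem_enum.
Qed.

Section Desc.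
Variables (N : lmodType R) (g : forall i, {linear M i -> N}).

(** A finitely supported sum over all indices needs no chosen support; [dsum_desc_sum] evaluates it
    on any list covering the support. *)
Definition dsum_desc_fun (v : dsum) : N := \sum_(i \in setT) g i (v i).

Lemma dsum_desc_sum (l : seq I) (v : dsum) : uniq l ->
  (forall i, i \notin l -> v i = 0) ->
    dsum_desc_fun v = \sum_(i <- l) g i (v i).
Proof.
move=> ul vl; rewrite /dsum_desc_fun (@fsbigE _ _ _ _ _ l)//.
  by apply: eq_bigl => i; exact: in_setT.
by move=> i _ il; rewrite vl ?linear0.
Qed.

Lemma dsum_desc_linear : linear dsum_desc_fun.
Proof.
move=> a v w; have [l vl] := dsum_fin v; have [k wk] := dsum_fin w.
have u : uniq (undup (l ++ k)) by exact: undup_uniq.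
have ml i : i \notin undup (l ++ k) -> v i = 0 /\ w i = 0.
  by rewrite mem_undup mem_cat negb_or => /andP[/vl -> /wk ->].
rewrite !(dsum_desc_sum u) ?scaler_sumr -?big_split /=; last first.
- by move=> i /ml[vi wi]; rewrite -[LHS]/(a *: v i + w i) vi wi scaler0 addr0.
- by move=> i /ml[].
- by move=> i /ml[].
by apply: eq_bigr => i _; rewrite -linearP.
Qed.

Definition dsum_desc : {linear dsum -> N} := linear_of dsum_desc_linear.

Lemma dsum_desc_in i x : dsum_desc (dsum_in i x) = g i x.
Proof.
rewrite /= (dsum_desc_sum (l := [:: i])) ?big_seq1 => [|//|j].
  by congr (g i _); exact: dsum_pr_in.
by rewrite inE eq_sym; exact: dfwith_out.
Qed.

End Desc.
End DirectSum.

(** * Functors on finitely presented modules *)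

(** This wrapper and the next ones present categorical data as linear maps, modules and groups, to
    which the algebraic lemmas apply. *)
Definition happ (R : pzRingType) (M N : lmodType R) (s : homgroup M N) :
  {linear M -> N} := s.

Definition lcomp (R : pzRingType) (U V W : lmodType R) (g : {linear V -> W})
  (f : {linear U -> V}) : {linear U -> W} := (g \o f : U -> W).

Definition ladd (R : pzRingType) (U V : lmodType R) (f g : {linear U -> V}) :
  {linear U -> V} := @homD (Mod R) U V f g.

Definition lsub (R : pzRingType) (U V : lmodType R) (f g : {linear U -> V}) :
  {linear U -> V} := (f \- g : U -> V).

Definition fp_mod (R : pzRingType) (N : fpmod R) : lmodType R := sval N.

Definition value (R : pzRingType) (F : functor (opcat (fpmod R)) Ab)
  (N : fpmod R) : zmodType := F N.

Section Restriction.
Variables (R : pzRingType) (F : functor (opcat (fpmod R)) Ab).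

Definition pull (N N' : fpmod R) (u : {linear fp_mod N -> fp_mod N'}) :
    {additive value F N' -> value F N} :=
  @fmap _ _ F N' N u.

Lemma pull1 (N : fpmod R) (u : {linear fp_mod N -> fp_mod N}) x :
  (forall y, u y = y) -> pull u x = x.
Proof.
move=> u1; have -> : u = idfun by exact: linear_ext.
exact: (congr1 (fun k : {additive value F N -> value F N} => k x) (fmap1 F N)).
Qed.

Lemma pull_comp (N N' N'' : fpmod R) (u : {linear fp_mod N -> fp_mod N'})
    (v : {linear fp_mod N' -> fp_mod N''}) x : pull (lcomp v u) x = pull u
      (pull v x).
Proof.
exact: (congr1 (fun k : {additive value F N'' -> value F N} => k x)
  (@fmapM _ _ F N'' N' N u v)).
Qed.

Lemma pullD (N N' : fpmod R) (u v : {linear fp_mod N -> fp_mod N'}) x :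
  pull (ladd u v) x = pull u x + pull v x.
Proof.
exact: (congr1 (fun k : {additive value F N' -> value F N} => k x)
  (@fmapD _ _ F N' N u v)).
Qed.

Lemma pull_ext (N N' : fpmod R) (u v : {linear fp_mod N -> fp_mod N'}) x :
  (forall y, u y = v y) -> pull u x = pull v x.
Proof. by move=> uv; have -> : u = v by exact: linear_ext. Qed.

Lemma pull0 (N N' : fpmod R) (u : {linear fp_mod N -> fp_mod N'}) x :
  (forall y, u y = 0) -> pull u x = 0.
Proof.
move=> u0; apply: (@addrI _ (pull u x)); rewrite addr0 -pullD.
by apply: pull_ext => y /=; rewrite u0 addr0.
Qed.

Lemma pullB (N N' : fpmod R) (u v : {linear fp_mod N -> fp_mod N'}) x :
  pull (lsub u v) x = pull u x - pull v x.
Proof.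
apply/eqP; rewrite -subr_eq opprK -pullD; apply/eqP.
by apply: pull_ext => y /=; rewrite subrK.
Qed.

End Restriction.

Lemma pull_nat (R : pzRingType) (F G : functor (opcat (fpmod R)) Ab)
  (a : nattrans F G) (N N' : fpmod R) (u : {linear fp_mod N -> fp_mod N'}) x :
  (a N : {additive value F N -> value G N}) (pull F u x) =
  pull G u ((a N' : {additive _ -> _}) x).
Proof. exact: nat_app. Qed.

Definition napp (R : pzRingType) (F : functor (opcat (fpmod R)) Ab) (P :
  lmodType R)
  (a : nattrans (hom_functor P) F) (N : fpmod R) (s : {linear fp_mod N -> P}) :
  value F N := (a N : {additive homgroup (fp_mod N) P -> value F N}) s.

Lemma napp_comp (R : pzRingType) (F : functor (opcat (fpmod R)) Ab) (P :
  lmodType R)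
    (a : nattrans (hom_functor P) F) (N N' : fpmod R)
    (u : {linear fp_mod N -> fp_mod N'}) (s : {linear fp_mod N' -> P}) :
  napp a (lcomp s u) = pull F u (napp a s).
Proof. exact: (@pull_nat _ _ _ a N N' u s). Qed.

Lemma homgroup_sumE (R : pzRingType) (M N : lmodType R) (J : Type) (r : seq J)
    (g : J -> homgroup M N) x : happ (\sum_(j <- r) g j) x = \sum_(j <- r) happ
      (g j) x.
Proof. by elim/big_rec2: _ => // j a b _ <-. Qed.

Section NatDirectSum.
Variables (R : pzRingType) (I : choiceType) (M : I -> fpmod R).
Let P : lmodType R := dsum (fun i => fp_mod (M i)).
Variable F : functor (opcat (fpmod R)) Ab.

(** A map from a finitely presented module meets finitely many summands, so it is a finite sum of
    maps through them; naturality does the rest. *)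
Lemma nat_dsum_sum (a : nattrans (hom_functor P) F) (N : fpmod R)
    (s : {linear fp_mod N -> P}) (l : seq I) :
  uniq l -> (forall i, i \notin l -> forall x, s x i = 0) ->
  napp a s = \sum_(i <- l) pull F (lcomp (dsum_pr _ i) s) (napp a (dsum_in _
    i)).
Proof.
move=> ul ls.
transitivity ((a N : {additive homgroup (fp_mod N) P -> value F N})
  (\sum_(i <- l) (lcomp (dsum_in _ i) (lcomp (dsum_pr _ i) s) : homgroup
    (fp_mod N) P))).
  congr (_ _); apply: linear_ext => x.
  rewrite -[RHS]/(happ _ x) homgroup_sumE.
  exact: (dsum_decomp ul (fun i il => ls i il x)).
rewrite raddf_sum; apply: eq_bigr => i _.
exact: (@napp_comp _ _ _ a N (M i)).
Qed.

Lemma nat_dsum_ext (a b : nattrans (hom_functor P) F) :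
  (forall i, napp a (dsum_in _ i) = napp b (dsum_in _ i)) -> a = b.
Proof.
move=> ab; apply: nattrans_ext => N; apply: additive_ext => s.
have [l ul ls] := fp_dsum_support s (svalP N).
apply: (etrans (nat_dsum_sum a ul ls)); apply: esym.
apply: (etrans (nat_dsum_sum b ul ls)); apply: eq_bigr => i _.
by rewrite ab.
Qed.

Variable x : forall i, value F (M i).

Definition nat_dsum_fun (N : fpmod R) (s : homgroup (fp_mod N) P) : value F N :=
  \sum_(i \in setT) pull F (lcomp (dsum_pr _ i) (happ s)) (x i).

Lemma nat_dsum_funE (N : fpmod R) (s : homgroup (fp_mod N) P) (l : seq I) :
  uniq l -> (forall i, i \notin l -> forall y, happ s y i = 0) ->
  nat_dsum_fun s = \sum_(i <- l) pull F (lcomp (dsum_pr _ i) (happ s)) (x i).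
Proof.
move=> ul ls; rewrite /nat_dsum_fun (@fsbigE _ _ _ _ _ l)//.
  by apply: eq_bigl => i; exact: in_setT.
by move=> i _ il; apply: pull0 => y; exact: ls.
Qed.

Lemma nat_dsum_zmod_morphism (N : fpmod R) : zmod_morphism (@nat_dsum_fun N).
Proof.
move=> s t; have [l ul ls] := fp_dsum_support (happ s) (svalP N).
have [k uk kt] := fp_dsum_support (happ t) (svalP N).
have u : uniq (undup (l ++ k)) by exact: undup_uniq.
have sup i : i \notin undup (l ++ k) -> i \notin l /\ i \notin k.
  by rewrite mem_undup mem_cat negb_or => /andP[].
rewrite !(nat_dsum_funE u) -?sumrB; last first.
- by move=> i /sup[/ls is_ /kt it] y;
  rewrite -[LHS]/(happ s y i - happ t y i) is_ it subrr.
- by move=> i /sup[/ls].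
- by move=> i /sup[_ /kt].
by apply: eq_bigr => i _; rewrite -pullB; apply: pull_ext.
Qed.

(** Yoneda's lemma for a direct sum: a family of elements of the groups [F (M i)] defines a
    transformation from [(-, P)]. *)
Definition nat_dsum : nattrans (hom_functor P) F.
Proof.
refine (@NatTrans _ _ (hom_functor P) F
  (fun N => additive_of (@nat_dsum_zmod_morphism N)) _).
move=> N N' u; apply: additive_ext => s.
have [l ul ls] := fp_dsum_support (happ s) (svalP N).
apply: (etrans (@nat_dsum_funE N' _ l ul _)); first by move=> i il y; exact: ls.
apply: esym; apply: (etrans (congr1 _ (nat_dsum_funE ul ls))).
rewrite raddf_sum; apply: eq_bigr => i _; apply: esym.
apply: (etrans _ (@pull_comp _ F N' N (M i) u (lcomp (dsum_pr _ i) (happ s)) (x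
  i))).
exact: pull_ext.
Defined.

Lemma nat_dsum_in i : napp nat_dsum (dsum_in _ i) = x i.
Proof.
apply: (etrans (@nat_dsum_funE (M i) (dsum_in _ i) [:: i] _ _)) => //.
  by move=> j; rewrite inE eq_sym => ij y; exact: dsum_pr_in_neq.
rewrite big_seq1; apply: pull1 => y; exact: dsum_pr_in.
Qed.

End NatDirectSum.

Definition presentation (R : pzRingType) : Type :=
  {m : nat & {n : nat & {linear 'rV[R]_m -> 'rV[R]_n}}}.

Definition presented (R : pzRingType) (t : presentation R) : fpmod R :=
  exist _ (Cok (projT2 (projT2 t)) : lmodType R) (Cok_finitely_presented _).

(* Finitely presented modules form a proper class; presentations are a set of *)
(* representatives. *)
Lemma functor_cover (R : pzRingType) (F : functor (opcat (fpmod R)) Ab)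
    (S : forall N : fpmod R, value F N -> Prop) :
  (forall N N' (u : {linear fp_mod N -> fp_mod N'}) y, S N' y ->
    S N (pull F u y)) ->
  exists (I : choiceType) (M : I -> fpmod R) (x : forall i, value F (M i)),
  (forall i, S (M i) (x i)) /\
  forall (N : fpmod R) (y : value F N), S N y ->
    exists i (u : {linear fp_mod N -> fp_mod (M i)}), pull F u (x i) = y.
Proof.
move=> SP.
(* One index for each presentation and each element of [S] over it; [u] and [v] below identify a
   general [N] with a presented module. *)
pose I : choiceType := {classic {t : presentation R & {y : value F (presented
  t) | S _ y}}}.
exists I, (fun i : I => presented (projT1 i)), (fun i : I => sval (projT2 i));
  split.
  by move=> i; exact: (svalP (projT2 i)).
move=> N y Sy.
have [m [n [q [p [ps pq]]]]] := svalP N.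
pose t : presentation R := existT _ m (existT _ n q).
have [|u uE] := factor_surjective (p := p) (g := pi_Cok q) ps.
  by move=> v /pq/pi_Cok_eq0.
have [|v vE] := factor_surjective (p := pi_Cok q) (g :=
  p) (@pi_Cok_onto _ _ _ _).
  by move=> w /pi_Cok_eq0/pq.
exists (existT _ t (exist _ _ (SP (presented t) N v y Sy))), u.
rewrite -[LHS](@pull_comp _ F N (presented t) N); apply: pull1 => z /=.
by have [w <-] := ps z; rewrite uE vE.
Qed.

(** * Objectivity *)

Section PsiClass.
Variables (R : pzRingType) (f : morcat (Mod R)) (M : fpmod R).

Definition Psi_class (s : {linear fp_mod M ->
  Cok (arr f)}) : value (Psi_obj f) M :=
  cokpi (hom_nat (pi_Cok (arr f)) M) s.

Lemma Psi_class_eq0 s : Psi_class s = 0 <->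
  exists k : {linear fp_mod M -> tgt f}, forall x, pi_Cok (arr f) (k x) = s x.
Proof.
apply: (iff_trans (cokpi_eq0 _ _)); split=> -[k kE]; exists k.
  by move=> x; exact: (congr1 (fun u => happ u x) kE).
exact: linear_ext.
Qed.

Lemma Psi_class_onto (c : value (Psi_obj f) M) : exists s, Psi_class s = c.
Proof. by exists (cokrepr c); exact: cokreprK. Qed.

End PsiClass.

Lemma zero_object_stable (R : pzRingType) (F : stable_funcat R) :
  (forall (M : fpmod R) (x : value (sval F) M), x = 0) -> zero_object F.
Proof.
move=> F0 G; split=> k; apply: nattrans_ext => M; apply: additive_ext => x.
  by rewrite (F0 M x) !raddf0.
exact: F0.
Qed.

Lemma Psi_objective (R : pzRingType) : objective_functor (Psi R).
Proof.
move=> [f [fi piX piY]] [f' [f'i piX' piY']] h h0.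
(* Vanishing of [Psi h] says that the induced map of cokernels lifts over each finitely presented
   module. *)
have [w wE] : exists w : {linear Cok (arr f) -> tgt f'},
    forall x, pi_Cok (arr f') (w x) = square_cok h x.
  apply: (lift_of_local_lifts (pure_injective_limits piX') f'i) => M s fpM.
  pose M' : fpmod R := exist _ M fpM.
  apply/(@Psi_class_eq0 R f' M' (square_cok h \o s)).
  have hM : fmap (Psi R) h M' = @hom0 Ab _ _ by rewrite h0.
  have := congr1 (fun k : {additive _ -> _} => k (@Psi_class R f M' s)) hM.
  exact: etrans (esym (Psi_homE h (s : homgroup (sval M') (Cok (arr f))))).
(* Here [f' t = h2 - w pi], and restricting to [X] gives [t f = h1]: a null-homotopy of [h]. *)
have [|t tE] := factor_injective
    (g := (sq2 h : {linear tgt f -> tgt f'}) \- (w \o pi_Cok (arr f))) f'i.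
  move=> y; apply/pi_Cok_eq0; rewrite linearB /= wE.
  by rewrite [X in _ - X](square_cokE h y) subrr.
have inlL : linear (fun x => (x, 0) : src f' * tgt f').
  by move=> a x y; congr pair; rewrite /= scaler0 addr0.
have foldL : linear (fun y : src f' * tgt f' => (arr f' : {linear _ ->
  _}) y.1 + y.2).
  by move=> a x y /=; rewrite linearP scalerDr addrACA.
(* The split monomorphism [X' -> X' * Y'] is a kernel object, since all maps into its cokernel lift.
   The map into it has second component [(t, w pi)], the map out of it [f' + id]. *)
pose K : morcat (Mod R) :=
  @Arrow (Mod R) (src f') ((src f' * tgt f')%type : lmodType R) (linear_of
    inlL).
have mK : mono_Pinj K by split=> //;
  [move=> x y [] | exact: pure_injective_prod].
exists (exist _ K mK); split.
  apply: zero_object_stable => M c; have [s <-] := @Psi_class_onto _ K M c.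
  apply/Psi_class_eq0.
  have inrL : linear (fun y => (0, y) : src f' * tgt f').
    by move=> a x y; congr pair; rewrite /= scaler0 addr0.
  have [|p pE] := factor_surjective (p := pi_Cok (linear_of inlL))
      (g := snd : {linear (src f' * tgt f')%type ->
        tgt f'}) (@pi_Cok_onto _ _ _ _).
    by move=> _ /pi_Cok_eq0[x <-].
  exists (linear_of inrL \o (p \o s)) => x /=.
  have [[x1 y1] yE] := pi_Cok_onto (s x); rewrite -yE pE /=.
  by apply/subr0_eq; rewrite -linearB; apply/pi_Cok_eq0; exists (- x1);
    congr pair;
    rewrite /= ?sub0r ?subrr.
have uL : linear (fun y => (t y, w (pi_Cok (arr f) y)) : src f' * tgt f').
  by move=> a x y; rewrite !linearP.
have uP : (linear_of uL : @hom (Mod R) (tgt f) (tgt K)) \c arr f = arr K \c sq1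
  h.
  apply: linear_ext => x; congr pair.
    apply: (f'i); rewrite tE /= [lcokpi _ _]pi_Cok_im linear0 subr0.
    exact: square_app.
  by rewrite /= [lcokpi _ _]pi_Cok_im linear0.
have vP : (linear_of foldL : @hom (Mod R) (tgt K) (tgt f')) \c arr K =
    arr f' \c idm (src f').
  by apply: linear_ext => x; exact: addr0.
exists (@Square _ f K (sq1 h) (linear_of uL) uP).
exists (@Square _ K f' (idm (src f')) (linear_of foldL) vP).
apply: square_ext; apply: linear_ext => x //.
by apply: esym; rewrite /= tE subrK.
Qed.

(** * Fullness *)

Lemma row_finitely_presented (R : pzRingType) n :
  finitely_presented 'rV[R]_n.
Proof.
exists 0, n, (\0 : 'rV[R]_0 -> 'rV[R]_n), idfun; split=> [v|v];
  first by exists v.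
by split=> [v0|[w <-]//]; exists 0; exact: esym v0.
Qed.

(** These are the pure epimorphisms. *)
Definition locally_onto (R : pzRingType) (P Z : lmodType R) (p : {linear P ->
  Z}) :=
  forall (M : lmodType R) (s : {linear M -> Z}), finitely_presented M ->
    exists t : {linear M -> P}, forall x, p (t x) = s x.

Lemma locally_onto_surjective (R : pzRingType) (P Z : lmodType R)
  (p : {linear P -> Z}) : locally_onto p -> forall z, exists x, p x = z.
Proof.
move=> lp z; have [t tE] := lp _ (row_map (fun _ : 'I_1 => z))
  (row_finitely_presented R 1).
by exists (t (delta_mx 0 0)); rewrite tE; exact: row_map_delta.
Qed.

(** The cokernel of [ker p -> P] embeds in [Z], so a lift along [p] is a lift along the quotient
    map. *)
Lemma locally_onto_pure (R : pzRingType) (P Z : lmodType R)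
  (p : {linear P -> Z}) : locally_onto p -> pure_mono (ker_incl p).
Proof.
move=> lp; split=> [|M h fpM]; first exact: ker_incl_inj.
have [|q qE] := factor_surjective (p := pi_Cok (ker_incl p)) (g :=
  p) (@pi_Cok_onto _ _ _ _).
  by move=> u /pi_Cok_eq0/ker_incl_im.
have [t tE] := lp M (lcomp q h) fpM.
exists t => x; have [y yE] := pi_Cok_onto (h x); rewrite -yE.
apply/subr0_eq; rewrite -linearB; apply/pi_Cok_eq0/ker_incl_im.
by rewrite linearB tE /= -yE qE subrr.
Qed.

Lemma Psi_class_ext (R : pzRingType) (f : morcat (Mod R)) (M : fpmod R)
    (s t : {linear fp_mod M -> Cok (arr f)}) :
  (forall x, s x = t x) -> Psi_class s = Psi_class t.
Proof. by move=> st; have -> : s = t by exact: linear_ext. Qed.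

Lemma Psi_classB (R : pzRingType) (f : morcat (Mod R)) (M : fpmod R)
    (s t : {linear fp_mod M -> Cok (arr f)}) :
  Psi_class (lsub s t) = Psi_class s - Psi_class t.
Proof.
rewrite -(raddfB (cokpi (hom_nat (pi_Cok (arr f)) M))).
by apply: Psi_class_ext.
Qed.

Lemma Psi_full (R : pzRingType) : full_functor (Psi R).
Proof.
move=> [f [fi piX piY]] [f' [f'i piX' piY']] k.
pose kv (N : fpmod R) : {additive value (Psi_obj f) N ->
  value (Psi_obj f') N} := k N.
have [I [M [x [_ xP]]]] :=
  @functor_cover _ (hom_functor (Cok (arr f))) (fun _ _ => True) (fun _ _ _ _ _
    => Logic.I).
pose p := dsum_desc (fun i => happ (x i)).
have lp : locally_onto p.
  move=> N s fpN; have [i [u us]] := xP (exist _ N fpN) s Logic.I.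
  exists (lcomp (dsum_in _ i) u) => y; apply: etrans (dsum_desc_in _ _) _.
  exact: (congr1 (fun t => happ t y) us).
have gP i := Psi_class_onto (kv (M i) (Psi_class (happ (x i)))).
pose g := dsum_desc (fun i => sval (cid (gP i))).
(* Both sides are natural in [s], so it suffices to compare them on the inclusions of summands,
   where [g] was chosen to fit. *)
have gE (N : fpmod R) s : Psi_class (lcomp g s) = kv N (Psi_class (lcomp p s)).
  pose a := nt_comp (cok_nat (hom_nat (pi_Cok (arr f')))) (hom_nat g).
  pose b := nt_comp k (nt_comp (cok_nat (hom_nat (pi_Cok (arr f)))) (hom_nat
    p)).
  suff ab : a = b by exact: (congr1 (fun c => napp c s) ab).
  apply: nat_dsum_ext => i.
  apply: (etrans (Psi_class_ext (t := sval (cid (gP i))) _)).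
    by move=> y; exact: dsum_desc_in.
  apply: (etrans (svalP (cid (gP i)))); apply: (congr1 (kv (M i))).
  by apply: Psi_class_ext => y; apply: esym; exact: dsum_desc_in.
have kill (N : fpmod R) (s : {linear fp_mod N -> Cok (arr f)}) :
  Psi_class s = 0 -> kv N (Psi_class s) = 0 by move=> ->; exact: raddf0.
have Z0 (N : fpmod R) (s : {linear fp_mod N -> Cok (arr f)}) :
    (forall y, s y = 0) -> Psi_class s = 0.
  by move=> s0; apply/Psi_class_eq0; exists \0 => y; rewrite s0 linear0.
have [|w wE] := lift_of_local_lifts (u := lcomp g (ker_incl p))
    (pure_injective_limits piX') f'i.
  move=> N s fpN; apply/(@Psi_class_eq0 R f' (exist _ N fpN) (lcomp g (lcomp
    (ker_incl p) s))).
  rewrite gE; apply: kill; apply: Z0 => y.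
  exact: (ker_incl_im p _).2 (ex_intro _ (s y) erefl).
(* [w] lifts [g] on [ker p]. Its extension [e] to [P] makes [g - pi e] vanish on [ker p], so that it
   descends to [h3], while classes are unchanged because [pi e] lifts to [Y']. *)
have [e eE] := piY' _ _ _ w (locally_onto_pure lp).
have [|h3 h3E] := factor_surjective (p := p) (g :=
  lsub g (lcomp (pi_Cok (arr f')) e))
    (locally_onto_surjective lp).
  by move=> y /ker_incl_im[l <-]; rewrite /= eE [lcokpi _ _]wE subrr.
have h3P (N : fpmod R) (s : {linear fp_mod N -> Cok (arr f)}) :
    Psi_class (lcomp h3 s) = kv N (Psi_class s).
  have [t tE] := lp _ s (svalP N).
  transitivity (Psi_class (lsub (lcomp g t) (lcomp (pi_Cok (arr f')) (lcomp e
    t)))).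
    by apply: Psi_class_ext => y; rewrite /= -tE h3E.
  rewrite Psi_classB gE [X in _ - X](_ : _ = 0) ?subr0; last first.
    by apply/Psi_class_eq0; exists (lcomp e t).
  by congr (kv N _); exact: Psi_class_ext.
(* Maps into [Cok f] that factor through [Y] have class 0, and [k] preserves this; so [h3 pi] lifts
   locally. *)
have [|h2 h2E] := lift_of_local_lifts (u := lcomp h3 (pi_Cok (arr f)))
    (pure_injective_limits piX') f'i.
  move=> N s fpN; apply/(@Psi_class_eq0 R f' (exist _ N fpN) (lcomp h3 (lcomp
    (pi_Cok (arr f)) s))).
  by rewrite h3P; apply: kill; apply/Psi_class_eq0; exists s.
have [|h1 h1E] := factor_injective (m := arr f' : {linear _ -> _})
    (g := lcomp h2 (arr f)) f'i.
  move=> y; apply/pi_Cok_eq0; rewrite [LHS]h2E.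
  by rewrite /= [lcokpi _ _]pi_Cok_im linear0.
have sqE : (h2 : @hom (Mod R) (tgt f) (tgt f')) \c arr f = arr f' \c h1.
  by apply: linear_ext => y; exact/esym/h1E.
exists (@Square _ f f' h1 h2 sqE).
apply: nattrans_ext => N; apply: additive_ext => c.
have [s <-] := @Psi_class_onto R f N c.
apply: (etrans (Psi_homE _ (s : homgroup (fp_mod N) _)));
  apply: (etrans _ (h3P N s)).
apply: Psi_class_ext => y; have [z zE] := pi_Cok_onto (s y).
have sqz := square_cokE (@Square _ f f' h1 h2 sqE) z.
by change (square_cok (@Square _ f f' h1 h2 sqE) (s y) = h3 (s y));
  rewrite -zE sqz; exact: h2E.
Qed.

(** * Density *)

Lemma injective_eq0 (R : pzRingType) (U V : lmodType R) (f : {linear U ->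
  V}) x :
  injective f -> f x = 0 -> x = 0.
Proof. by move=> fi fx; apply: fi; rewrite linear0. Qed.

(** Let [X] be the double dual of [ker d], [Q] the pushout of [P1] along [ker d -> X], and [Y] the
    double dual of [Q]. Then [Q / X] is [P0] and [th] embeds it in [Y / X]. Purity of [Q] in [Y]
    makes [(-, P0)] map onto [Psi f]; purity of [ker d] in [X] identifies the kernel with the maps
    that lift to [P1]. *)
Lemma pure_injective_copresentation (R : pzRingType) (P1 P0 : lmodType R)
    (d : {linear P1 -> P0}) : (forall z, exists y, d y = z) ->
  exists (X Y : lmodType R) (f : {linear X -> Y}) (th : {linear P0 -> Cok f}),
  [/\ pure_injective X, pure_injective Y, injective f &
   forall N : lmodType R, finitely_presented N ->
    (forall t : {linear N -> Cok f}, exists (s : {linear N ->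
      P0}) (k : {linear N -> Y}),
       forall x, th (s x) = t x - pi_Cok f (k x)) /\
    (forall s : {linear N -> P0},
       (exists k : {linear N -> Y}, forall x, pi_Cok f (k x) = th (s x)) <->
       (exists m : {linear N -> P1}, forall x, d (m x) = s x))].
Proof.
move=> ds; pose i := ker_incl d.
pose h : {linear kernel d -> dual2 (kernel d)} := @to_dual2 _ _.
have [hi hpure] : pure_mono h := to_dual2_pure _.
have [Q [iX [jP [ij Qgen ij0 Quniv]]]] := pushout i h.
pose j : {linear Q -> dual2 Q} := @to_dual2 _ _.
have [ji jpure] : pure_mono j := to_dual2_pure _.
have iXi : injective iX.
  apply: linear_inj => x x0; have := ij0 x 0; rewrite linear0 addr0 => /(_ x0).
  move=> [a [-> /esym/eqP]]; rewrite oppr_eq0 => /eqP /(injective_eq0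
    (@ker_incl_inj _ _ _ d)) ->.
  exact: linear0.
have jPi : injective jP.
  apply: linear_inj => b b0; have := ij0 0 b; rewrite linear0 add0r => /(_ b0).
  by move=> [a [/esym/(injective_eq0 hi) -> ->]]; rewrite linear0 oppr0.
pose f := lcomp j iX.
have [|th thE] := factor_surjective (p := d) (g :=
  lcomp (pi_Cok f) (lcomp j jP)) ds.
  move=> _ /ker_incl_im[a <-]; apply/pi_Cok_eq0.
  by exists (h a); congr (j _); exact: ij.
(* The projection [Y / X -> Y / Q], whose kernel is the image of [th]. *)
have [|ze zeE] := factor_surjective (p := pi_Cok f) (g :=
  pi_Cok j) (@pi_Cok_onto _ _ _ _).
  by move=> _ /pi_Cok_eq0[x <-]; exact: pi_Cok_im.
have thi : injective th.
  apply: linear_inj => z; have [b <-] := ds z;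
    rewrite thE => /pi_Cok_eq0[x] /ji xb.
  have [|a [_ ba]] := ij0 x (- b); first by rewrite xb linearN subrr.
  by apply/ker_incl_im; exists a; apply: oppr_inj.
have zeth z : ze (th z) = 0.
  by have [b <-] := ds z; rewrite thE [LHS]zeE; exact: pi_Cok_im.
have th_im z : ze z = 0 -> exists p, th p = z.
  have [y <-] := pi_Cok_onto z; rewrite zeE => /pi_Cok_eq0[q <-].
  have [x [b ->]] := Qgen q; exists (d b); rewrite thE !linearD.
  by rewrite [X in X + _](_ : _ = 0) ?add0r//; apply/pi_Cok_eq0; exists x.
exists (dual2 (kernel d)), (dual2 Q), f, th; split.
- exact: dual2_pure_injective.
- exact: dual2_pure_injective.
- by move=> x y /ji/iXi.
move=> N fpN; split=> [t|s].
  have [k kE] := jpure N (lcomp ze t) fpN.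
  have [|s sE] := factor_injective (g := lsub t (lcomp (pi_Cok f) k)) thi.
    move=> x; apply: th_im; rewrite linearB; apply/eqP; rewrite subr_eq0;
      apply/eqP.
    exact: etrans (esym (kE x)) (esym (zeE (k x))).
  by exists s, k.
split=> [[k kE]|[m mE]]; last first.
  by exists (lcomp j (lcomp jP m)) => x; rewrite -mE thE.
have [|k' k'E] := factor_injective (g := k) ji.
  by move=> x; apply/pi_Cok_eq0; rewrite -zeE kE.
(* [rho] maps [Q] to [X / ker d] with kernel [P1]; lifting [rho k'] to [X] corrects [k'] to a map
   into [P1]. *)
have [|rho [rhoX rhoP]] := Quniv _ (pi_Cok h) \0.
  by move=> a; exact: pi_Cok_im.
have [l lE] := hpure N (lcomp rho k') fpN.
have [|m mE] := factor_injective (g := lsub k' (lcomp iX l)) jPi.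
  move=> x; have : rho (lsub k' (lcomp iX l) x) = 0 by rewrite linearB rhoX lE
    subrr.
  have [y [b ->]] := Qgen (lsub k' (lcomp iX l) x).
  rewrite linearD rhoX rhoP addr0 => /pi_Cok_eq0[a <-].
  by exists (i a + b); rewrite linearD ij.
exists m => x; apply: thi; rewrite thE -kE.
change (pi_Cok f (j (jP (m x))) = pi_Cok f (k x)); rewrite mE -k'E.
apply/subr0_eq; rewrite -linearB; apply/pi_Cok_eq0; exists (- l x).
by rewrite -linearB /= linearN addrAC subrr add0r linearN.
Qed.

Lemma row_projective (R : pzRingType) n : projective 'rV[R]_n.
Proof.
move=> A B g h gs; pose c j := sval (cid (gs (h (delta_mx 0 j)))).
have cE j : g (c j) = h (delta_mx 0 j) := svalP (cid (gs _)).
exists (row_map c).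
apply: (@linear_row_ext _ _ _ (g \o row_map c) h) => j /=.
by rewrite row_map_delta.
Qed.

Definition nval (R : pzRingType) (F G : functor (opcat (fpmod R)) Ab)
  (a : nattrans F G) (N : fpmod R) : {additive value F N -> value G N} := a N.

Lemma nat_factor (R : pzRingType) (G F F' : functor (opcat (fpmod R)) Ab)
    (a : nattrans G F) (b : nattrans G F') :
  (forall N y, exists x, nval a N x = y) ->
  (forall N x, nval a N x = 0 -> nval b N x = 0) ->
  exists c : nattrans F F', forall N x, nval c N (nval a N x) = nval b N x.
Proof.
move=> as_ ab; pose s N y := sval (cid (as_ N y)).
have sE N y : nval a N (s N y) = y := svalP (cid (as_ N y)).
have bE N x : nval b N (s N (nval a N x)) = nval b N x.
  by apply/subr0_eq; rewrite -raddfB ab// raddfB sE subrr.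
have cB N : zmod_morphism (fun y => nval b N (s N y)).
  by move=> x y; rewrite -{1}[x]sE -{1}[y]sE -!raddfB bE.
have cP N N' (u : {linear fp_mod N' -> fp_mod N}) y :
    nval b N' (s N' (pull F u y)) = pull F' u (nval b N (s N y)).
  have aN : pull F u y = nval a N' (pull G u (s N y)).
    by rewrite -{1}(sE N y); apply: esym; exact: (pull_nat a).
  by rewrite aN bE; exact: (pull_nat b).
have cN (N N' : opcat (fpmod R)) (u : hom N N') :
    (additive_of (cB N') : @hom Ab (F N') (F' N')) \c fmap F u =
    fmap F' u \c (additive_of (cB N) : @hom Ab (F N) (F' N)).
  by apply: additive_ext => y; exact: cP.
by exists (NatTrans cN) => N x; exact: bE.
Qed.

Lemma nat_iso (R : pzRingType) (G : functor (opcat (fpmod R)) Ab)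
    (F F' : stable_funcat R) (a : nattrans G (sval F)) (b : nattrans G (sval
      F')) :
  (forall N y, exists x, nval a N x = y) -> (forall N y, exists x,
    nval b N x = y) ->
  (forall N x, nval a N x = 0 <-> nval b N x = 0) -> isomorphic F F'.
Proof.
move=> as_ bs ab.
have [c cE] := nat_factor as_ (fun N x => (ab N x).1).
have [e eE] := nat_factor bs (fun N x => (ab N x).2).
exists c, e; split; apply: nattrans_ext => N; apply: additive_ext => y.
  have [x <-] := as_ N y.
  by change (nval e N (nval c N (nval a N x)) = nval a N x); rewrite cE eE.
have [x <-] := bs N y.
by change (nval c N (nval e N (nval b N x)) = nval b N x); rewrite eE cE.
Qed.

Lemma Psi_dense (R : pzRingType) : dense_functor (Psi R).
Proof.
move=> [F Fv].
have [I0 [M0 [x0 [_ x0P]]]] :=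
  @functor_cover _ F (fun _ _ => True) (fun _ _ _ _ _ => Logic.I).
pose P0 : lmodType R := dsum (fun i => fp_mod (M0 i)).
pose eta : nattrans (hom_functor P0) F := nat_dsum x0.
have [I1 [M1 [x1 [x1K x1P]]]] := @functor_cover _ (hom_functor P0)
  (fun N s => napp eta (happ s) = 0) (fun N N' u s s0 =>
     etrans (napp_comp eta u (happ s)) (etrans (congr1 (pull F u) s0) (raddf0
       (pull F u)))).
pose P1 : lmodType R := dsum (fun i => fp_mod (M1 i)).
pose d : {linear P1 -> P0} := dsum_desc (fun i => happ (x1 i)).
have dP (N : fpmod R) (s : {linear fp_mod N -> P0}) :
    napp eta s = 0 <-> exists m : {linear fp_mod N -> P1}, forall x,
      d (m x) = s x.
  split=> [/x1P[i [u us]]|[m mE]].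
    exists (lcomp (dsum_in _ i) u) => x; apply: etrans (dsum_desc_in _ _) _.
    exact: (congr1 (fun t => happ t x) us).
  have -> : s = lcomp d m by apply: linear_ext => x; exact: esym (mE x).
  pose z := nt_comp eta (hom_nat d).
  have z0 : z = nt0 _ _.
    apply: nat_dsum_ext => i.
    have dx : lcomp d (dsum_in _ i) = happ (x1 i).
      by apply: linear_ext => x; exact: dsum_desc_in.
    exact: (etrans (congr1 (napp eta (N := M1 i)) dx) (x1K i)).
  exact: (congr1 (fun c => napp c m) z0).
(* [F] vanishes on the projective module [R], so [eta] kills every map from [R] to [P0], and such
   maps lift along [d]. *)
have ds z : exists y, d y = z.
  pose N : fpmod R := exist _ ('rV[R]_1 : lmodType R) (row_finitely_presented R
    1).
  pose s : {linear fp_mod N -> P0} := row_map (fun _ : 'I_1 => z).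
  have [m mE] := (dP N s).1 (Fv N (@row_projective R 1) (napp eta s)).
  by exists (m (delta_mx 0 0)); rewrite mE; exact: row_map_delta.
have [X [Y [f [th [piX piY fi fP]]]]] := pure_injective_copresentation ds.
pose fo : morcat (Mod R) := @Arrow (Mod R) X Y f.
have mfo : mono_Pinj fo by [].
exists (exist _ fo mfo).
pose b : nattrans (hom_functor P0) (Psi_obj fo) :=
  nt_comp (cok_nat (hom_nat (pi_Cok f))) (hom_nat th).
apply: (@nat_iso R (hom_functor P0) (Psi R (exist _ fo mfo)) (exist _ F Fv) b
  eta).
- move=> N c; have [t <-] := @Psi_class_onto R fo N c.
  have [s [k sE]] := (fP _ (svalP N)).1 t; exists s.
  transitivity (@Psi_class R fo N (lsub t (lcomp (pi_Cok f) k))).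
    exact: Psi_class_ext.
  rewrite Psi_classB [X in _ - X](_ : _ = 0) ?subr0//.
  by apply/Psi_class_eq0; exists k.
- move=> N y; have [i [u <-]] := x0P N y Logic.I.
  exists (lcomp (dsum_in _ i) u); apply: etrans (napp_comp eta u (dsum_in _ i))
    _.
  by congr (pull F u _); exact: nat_dsum_in.
- move=> N s; apply: (iff_trans (@Psi_class_eq0 R fo N (lcomp th (happ s)))).
  apply: (iff_trans ((fP _ (svalP N)).2 (happ s))).
  exact: iff_sym (dP N (happ s)).
Qed.

Theorem theorem4p2 (R : pzRingType) :
  full_functor (Psi R) /\ dense_functor (Psi R) /\ objective_functor (Psi R).
Proof.
by split; [exact: Psi_full|split; [exact: Psi_dense|exact: Psi_objective]].
Qed.
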